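(* Let $\gamma\in\mathrm{PSL}(n+1,\mathbb{H})$ be a parabolic element having a lift to $\mathrm{SL}(n+1,\mathbb{H})$ which is in Jordan form: it is block diagonal and consists, in this order along the diagonal, of a diagonal block of size $k_1\ge 0$ and then, for $i=2,\dots,m$ (with $m\ge 2$), of $l_i\ge 1$ Jordan blocks of size $k_i\ge 2$, where $k_i<k_{i+1}$ for $2\le i\le m-1$ and $$k_1+\sum_{i=2}^m l_ik_i=n+1 .$$ Put $B=k_1+\sum_{i=2}^{m-1}l_ik_i$. Then the equicontinuity region of $\gamma$, i.e. $\mathrm{Eq}(\gamma)=\mathrm{Eq}(\langle\gamma\rangle)$, is $$\mathrm{Eq}(\gamma)=\mathbb{P}^n_{\mathbb{H}}\setminus L\big\{e_s : 1\le s\le n+1,\ s\ne B+jk_m \text{ for all } j=1,\dots,l_m\big\}.$$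
   Context: $\mathbb{H}$ is the division ring of quaternions; $\mathbb{H}^{n+1}$ is a right $\mathbb{H}$-vector space and $\mathbb{P}^n_{\mathbb{H}}=(\mathbb{H}^{n+1}\setminus\{0\})/\sim$, where $z\sim w$ iff $z=w\alpha$ for some $\alpha\in\mathbb{H}\setminus\{0\}$. $e_1,\dots,e_{n+1}$ denote the points of $\mathbb{P}^n_{\mathbb{H}}$ given by the standard basis vectors, and $L\{p_1,\dots,p_r\}$ (or $L$ of a set of points) is the smallest projective subspace (projectivization of an $\mathbb{H}$-linear subspace) containing the given points. Writing a quaternionic matrix as $A=A_1+A_2 j$ with $A_1,A_2$ complex, $\det_{\mathbb{H}}(A)=\det\begin{bmatrix}A_1&A_2\\-\overline{A_2}&\overline{A_1}\end{bmatrix}$; $\mathrm{SL}(n+1,\mathbb{H})=\{g:\det_{\mathbb{H}}(g)=1\}$, $\mathrm{PSL}(n+1,\mathbb{H})=\mathrm{SL}(n+1,\mathbb{H})/\{\pm I\}$, acting on $\mathbb{P}^n_{\mathbb{H}}$ via the linear action on $\mathbb{H}^{n+1}$. A Jordan block $\mathrm{J}(\lambda,k)$ is the $k\times k$ matrix with $\lambda$ on the diagonal, $1$ on the superdiagonal and $0$ elsewhere, where $\lambda$ is a complex number with non-negative imaginary part (the chosen representative of the similarity class of right eigenvalues). Different blocks may have different eigenvalues. An element of $\mathrm{PSL}(n+1,\mathbb{H})$ is parabolic if it is not semisimple (no lift is diagonalizable over $\mathbb{H}$) and all its (right) eigenvalues have modulus $1$. A family of maps from a topological space into $\mathbb{P}^n_{\mathbb{H}}$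 is normal if every sequence in it has a subsequence converging uniformly on compact subsets. For a subgroup $G\le \mathrm{PSL}(n+1,\mathbb{H})$, $\mathrm{Eq}(G)$ is the set of $z\in\mathbb{P}^n_{\mathbb{H}}$ having an open neighborhood $U$ such that $\{g|_U: g\in G\}$ is normal. *)

(* Defs.v *)
From HB Require Import structures.
From mathcomp Require Import all_boot all_order all_algebra.
From mathcomp Require Import all_classical all_reals all_analysis.
From mathcomp Require Import complex.
From mathcomp Require Import ring lra.

Set Implicit Arguments.
Unset Strict Implicit.
Unset Printing Implicit Defensive.

Import Order.TTheory GRing.Theory Num.Theory.
Import numFieldNormedType.Exports.

Local Open Scope classical_set_scope.
Local Open Scope ring_scope.

(* Quaternions: [Quat a b] stands for a + b j, with j c = c^* j and j^2 = -1. *)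

Record quat (R : realType) := Quat { qa : R[i]; qb : R[i] }.

Section QuatRing.
Variable R : realType.
Local Notation H := (quat R).
Implicit Types (x y : H) (r : R).

Definition quat_pair x : R[i] * R[i] := (qa x, qb x).
Definition pair_quat (p : R[i] * R[i]) : H := Quat p.1 p.2.
Lemma quat_pairK : cancel quat_pair pair_quat. Proof. by case. Qed.
HB.instance Definition _ := Choice.copy H (can_type quat_pairK).

Definition addq x y := Quat (qa x + qa y) (qb x + qb y).
Definition oppq x := Quat (- qa x) (- qb x).
Definition mulq x y := Quat (qa x * qa y - qb x * (qb y)^*%C)
                            (qa x * qb y + qb x * (qa y)^*%C).
Definition scaleq r x := Quat (r%:C%C * qa x) (r%:C%C * qb x).

Lemma addqA : associative addq.
Proof. by move=> x y z; rewrite /addq /= !addrA. Qed.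
Lemma addqC : commutative addq.
Proof. by move=> x y; rewrite /addq (addrC (qa x)) (addrC (qb x)). Qed.
Lemma add0q : left_id (Quat 0 0) addq.
Proof. by case=> a b; rewrite /addq /= !add0r. Qed.
Lemma addNq : left_inverse (Quat 0 0) oppq addq.
Proof. by move=> x; rewrite /addq /= !addNr. Qed.
HB.instance Definition _ := GRing.isZmodule.Build H addqA addqC add0q addNq.

Lemma mulqA : associative mulq.
Proof.
move=> [a b] [c d] [e f]; rewrite /mulq /=.
by congr Quat; rewrite !(rmorphB, rmorphD, rmorphM) /= ?conjcK; ring.
Qed.
Lemma mul1q : left_id (Quat 1 0) mulq.
Proof. by move=> [a b]; rewrite /mulq /= !mul1r !mul0r subr0 addr0. Qed.
Lemma mulq1 : right_id (Quat 1 0) mulq.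
Proof.
case=> a b; rewrite /mulq.
rewrite [qa (Quat 1 0)]/= [qb (Quat 1 0)]/= (rmorph0 (@conjc R)).
by rewrite (rmorph1 (@conjc R)) !mulr1 !mulr0 subr0 add0r.
Qed.
Lemma mulqDl : left_distributive mulq addq.
Proof. by move=> x y z; rewrite /mulq /addq /=; congr Quat; ring. Qed.
Lemma mulqDr : right_distributive mulq addq.
Proof.
by move=> x y z; rewrite /mulq /addq /= !rmorphD /=; congr Quat; ring.
Qed.
Lemma quat1_neq0 : Quat 1 0 != 0 :> H.
Proof. by apply/eqP => -[] /eqP; rewrite oner_eq0. Qed.
HB.instance Definition _ := GRing.Zmodule_isNzRing.Build H
  mulqA mul1q mulq1 mulqDl mulqDr quat1_neq0.

Lemma scaleqA r s x : scaleq r (scaleq s x) = scaleq (r * s) x.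
Proof. by rewrite /scaleq /= rmorphM !mulrA. Qed.
Lemma scale1q : left_id 1 scaleq.
Proof. by case=> a b; rewrite /scaleq /= rmorph1 !mul1r. Qed.
Lemma scaleqDr : right_distributive scaleq +%R.
Proof. by move=> r x y; rewrite /scaleq /= !mulrDr. Qed.
Lemma scaleqDl x : {morph scaleq^~ x : r s / r + s}.
Proof. by move=> r s; rewrite /scaleq rmorphD /= !mulrDl. Qed.
HB.instance Definition _ := GRing.Zmodule_isLmodule.Build R H
  scaleqA scale1q scaleqDr scaleqDl.

Definition quatC (a : R[i]) : H := Quat a 0.

Definition conjq x := Quat (qa x)^*%C (- qb x).

Definition sqnormq x : R :=
  complex.Re (qa x) ^+ 2 + complex.Im (qa x) ^+ 2 + complex.Re (qb x) ^+ 2 + complex.Im (qb x) ^+ 2.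
Definition normq x : R := Num.sqrt (sqnormq x).

Lemma sqnormq_ge0 x : 0 <= sqnormq x.
Proof. by rewrite !addr_ge0 ?sqr_ge0. Qed.

Lemma sqnormq_eq0 x : (sqnormq x == 0) = (x == 0).
Proof.
apply/eqP/eqP => [|->]; last by rewrite /sqnormq /= !expr0n /= !addr0.
case: x => -[a b] [c d]; rewrite /sqnormq /= => /eqP.
rewrite !paddr_eq0 ?addr_ge0 ?sqr_ge0 // !sqrf_eq0.
by case/andP => /andP[/andP[/eqP-> /eqP->] /eqP->] /eqP->.
Qed.

Lemma sqnormqM x y : sqnormq (x * y) = sqnormq x * sqnormq y.
Proof.
by case: x y => -[a b] [c d] [[e f] [g h]]; rewrite /sqnormq /=; ring.
Qed.

Lemma normqM x y : normq (x * y) = normq x * normq y.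
Proof. by rewrite /normq sqnormqM sqrtrM ?sqnormq_ge0. Qed.

Lemma ler_normqD x y : normq (x + y) <= normq x + normq y.
Proof.
rewrite -(@ler_pXn2r _ 2) ?nnegrE ?addr_ge0 ?sqrtr_ge0 // sqrrD.
rewrite /normq !sqr_sqrtr ?sqnormq_ge0 // -sqrtrM ?sqnormq_ge0 //.
set N := Num.sqrt _.
pose dot := complex.Re (qa x) * complex.Re (qa y) + complex.Im (qa x) * complex.Im (qa y)
          + complex.Re (qb x) * complex.Re (qb y) + complex.Im (qb x) * complex.Im (qb y).
have le_dotN : dot <= N.
  rewrite (le_trans (ler_norm _)) // -sqrtr_sqr ler_wsqrtr // /dot /sqnormq.
  rewrite -subr_ge0.
  move: (qa x) (qb x) (qa y) (qb y) => [a b] [c d] [e f] [g h] /=.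
  rewrite (_ : _ - _ = (a * f - b * e) ^+ 2 + (a * g - c * e) ^+ 2
    + (a * h - d * e) ^+ 2 + (b * g - c * f) ^+ 2 + (b * h - d * f) ^+ 2
    + (c * h - d * g) ^+ 2); last by ring.
  by rewrite !addr_ge0 ?sqr_ge0.
have -> : sqnormq (x + y) = sqnormq x + dot *+ 2 + sqnormq y.
  by case: x y @dot {N le_dotN} => -[a b] [c d] [[e f] [g h]];
     rewrite /sqnormq /=; ring.
by rewrite lerD2r lerD2l lerMn2r le_dotN orbT.
Qed.

Lemma normqZ r x : normq (r *: x) = `|r| * normq x.
Proof.
rewrite /normq -sqrtr_sqr -sqrtrM ?sqr_ge0 //; congr Num.sqrt.
by case: x => -[a b] [c d]; rewrite /sqnormq /=; ring.
Qed.

Lemma normq0_eq0 x : normq x = 0 -> x = 0.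
Proof.
move/eqP; rewrite sqrtr_eq0 => n0; apply/eqP; rewrite -sqnormq_eq0.
by rewrite eq_le n0 sqnormq_ge0.
Qed.

HB.instance Definition _ :=
  Lmodule_isNormed.Build R H ler_normqD normqZ normq0_eq0.

Lemma quat_normE x : `|x| = normq x. Proof. by []. Qed.

Definition invq x := (sqnormq x)^-1 *: conjq x.

Lemma mulqJ x : x * conjq x = Quat (sqnormq x)%:C%C 0.
Proof.
case: x => -[a b] [c d]; apply/eqP; rewrite /eq_op /=; apply/andP; split;
  apply/eqP; rewrite /= /sqnormq /=; congr Complex; rewrite /=; ring.
Qed.

End QuatRing.

Section QuatUnit.
Variable R : realType.
Local Notation H := (quat R).
Implicit Types x y : H.

Lemma mulJq x : conjq x * x = Quat (sqnormq x)%:C%C 0.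
Proof.
case: x => -[a b] [c d]; apply/eqP; rewrite /eq_op /=; apply/andP; split;
  apply/eqP; rewrite /= /sqnormq /=; congr Complex; rewrite /=; ring.
Qed.

Lemma scaleqAl (r : R) x y : r *: (x * y) = (r *: x) * y.
Proof.
case: x y => [a b] [c d].
by congr Quat; rewrite /= mulrDr ?mulrN !mulrA.
Qed.

Lemma scaleqAr (r : R) x y : r *: (x * y) = x * (r *: y).
Proof.
case: x y => -[a b] [c d] [[e f] [g h]].
by congr Quat; congr Complex; rewrite /=; ring.
Qed.

Lemma mulVq : {in [pred x : H | x != 0], left_inverse 1 (@invq R) *%R}.
Proof.
move=> x; rewrite inE => x0; rewrite /invq -scaleqAl mulJq.
rewrite -sqnormq_eq0 in x0.
congr Quat; last exact: mulr0.
by rewrite /= -rmorphM /= mulVf.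
Qed.

Lemma mulqV : {in [pred x : H | x != 0], right_inverse 1 (@invq R) *%R}.
Proof.
move=> x; rewrite inE => x0; rewrite /invq -scaleqAr mulqJ.
rewrite -sqnormq_eq0 in x0.
congr Quat; last exact: mulr0.
by rewrite /= -rmorphM /= mulVf.
Qed.

Lemma unitqP x y : y * x = 1 /\ x * y = 1 -> [pred x : H | x != 0] x.
Proof.
by case=> yx _ /=; apply/eqP => x0; move/eqP: yx; rewrite x0 mulr0 eq_sym oner_eq0.
Qed.

Lemma invq_out : {in [predC [pred x : H | x != 0]], @invq R =1 id}.
Proof.
move=> x; rewrite !inE negbK => /eqP ->.
have c0 : conjq (0 : H) = 0.
  by congr Quat; [exact: (rmorph0 (@conjc R)) | exact: oppr0].
by rewrite /invq c0 scaler0.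
Qed.

HB.instance Definition _ := GRing.NzRing_hasMulInverse.Build H
  mulVq mulqV unitqP invq_out.

Lemma unitqE x : (x \is a GRing.unit) = (x != 0). Proof. by []. Qed.

Lemma conjqM x y : conjq (x * y) = conjq y * conjq x.
Proof.
case: x y => -[a b] [c d] [[e f] [g h]].
by congr Quat; congr Complex; rewrite /=; ring.
Qed.

End QuatUnit.

Section SL.
Variables (R : realType) (n : nat).
Local Notation H := (quat R).
Local Notation M := 'M[H]_n.+1.
Implicit Types A B : M.

(* writing A = A1 + A2 j, the complex matrix [A1, A2; - conj A2, conj A1] *)
Definition cplx_mx A : 'M[R[i]]_(n.+1 + n.+1) :=
  block_mx (map_mx (@qa R) A) (map_mx (@qb R) A)
    (- map_mx (@conjc R) (map_mx (@qb R) A))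
    (map_mx (@conjc R) (map_mx (@qa R) A)).

Definition detH A : R[i] := \det (cplx_mx A).

Lemma qa_sum (I : Type) (r : seq I) (P : pred I) (F : I -> H) :
  qa (\sum_(i <- r | P i) F i) = \sum_(i <- r | P i) qa (F i).
Proof. by apply: (big_morph (@qa R) (id1 := 0)). Qed.

Lemma qb_sum (I : Type) (r : seq I) (P : pred I) (F : I -> H) :
  qb (\sum_(i <- r | P i) F i) = \sum_(i <- r | P i) qb (F i).
Proof. by apply: (big_morph (@qb R) (id1 := 0)). Qed.

Lemma cplx_mxM A B : cplx_mx (A *m B) = cplx_mx A *m cplx_mx B.
Proof.
rewrite /cplx_mx mulmx_block.
have Ea : map_mx (@qa R) (A *m B) = map_mx (@qa R) A *m map_mx (@qa R) B
   - map_mx (@qb R) A *m map_mx (@conjc R) (map_mx (@qb R) B).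
  by apply/matrixP => i j; rewrite !mxE qa_sum -sumrB; apply: eq_bigr => k _;
     rewrite !mxE.
have Eb : map_mx (@qb R) (A *m B) = map_mx (@qa R) A *m map_mx (@qb R) B
   + map_mx (@qb R) A *m map_mx (@conjc R) (map_mx (@qa R) B).
  by apply/matrixP => i j; rewrite !mxE qb_sum -big_split; apply: eq_bigr => k _;
     rewrite !mxE.
have conjK m p (C : 'M[R[i]]_(m, p)) :
  map_mx (@conjc R) (map_mx (@conjc R) C) = C.
  by apply/matrixP => i j; rewrite !mxE conjcK.
rewrite Ea Eb map_mxB map_mxD !map_mxM !conjK.
move: (map_mx _ A) (map_mx _ A) (map_mx _ B) (map_mx _ B) => a b c d.
rewrite !mulmxN !mulNmx.
congr block_mx; first by rewrite opprD; apply: addrC.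
exact: addrC.
Qed.

Lemma cplx_mx1 : cplx_mx 1%:M = 1%:M.
Proof.
rewrite /cplx_mx scalar_mx_block.
have -> : map_mx (@qa R) (1%:M : M) = 1%:M.
  by apply/matrixP => i j; rewrite !mxE; case: (i == j).
have -> : map_mx (@qb R) (1%:M : M) = 0.
  by apply/matrixP => i j; rewrite !mxE; case: (i == j).
by rewrite map_mx1 map_mx0 oppr0.
Qed.

Lemma cplx_mxN A : cplx_mx (- A) = - cplx_mx A.
Proof.
rewrite /cplx_mx opp_block_mx.
have -> : map_mx (@qa R) (- A) = - map_mx (@qa R) A by apply/matrixP => i j; rewrite !mxE.
have -> : map_mx (@qb R) (- A) = - map_mx (@qb R) A by apply/matrixP => i j; rewrite !mxE.
by rewrite !map_mxN.
Qed.

Lemma cplx_mx_inj : injective cplx_mx.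
Proof.
move=> A B /eq_block_mx[/matrixP Ea /matrixP Eb _ _]; apply/matrixP => i j.
move: (Ea i j) (Eb i j); rewrite !mxE.
by case: (A i j) (B i j) => [a b] [c d] /= -> ->.
Qed.

Definition quat_mx (X : 'M[R[i]]_(n.+1 + n.+1)) : M :=
  \matrix_(i, j) Quat (ulsubmx X i j) (ursubmx X i j).

Lemma quat_mxK A X : X *m cplx_mx A = 1%:M -> cplx_mx (quat_mx X) = X.
Proof.
pose J : 'M[R[i]]_(n.+1 + n.+1) := block_mx 0 1%:M (- 1%:M) 0.
have conjK m p (C : 'M[R[i]]_(m, p)) :
  map_mx (@conjc R) (map_mx (@conjc R) C) = C.
  by apply/matrixP => i j; rewrite !mxE conjcK.
have JA : J *m map_mx (@conjc R) (cplx_mx A) = cplx_mx A *m J.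
  rewrite /J /cplx_mx map_block_mx !mulmx_block !map_mxN !conjK.
  by rewrite !mulmx0 !mul0mx !mulmxN !mulNmx !mulmx1 !mul1mx !addr0 !add0r ?opprK.
move=> XA; have AX := mulmx1C XA.
have cXA : map_mx (@conjc R) X *m map_mx (@conjc R) (cplx_mx A) = 1%:M.
  by rewrite -map_mxM XA map_mx1.
have AXc : map_mx (@conjc R) (cplx_mx A) *m map_mx (@conjc R) X = 1%:M.
  exact: mulmx1C cXA.
have JX : J *m map_mx (@conjc R) X = X *m J.
  by rewrite -[LHS]mul1mx -XA -!mulmxA (mulmxA (cplx_mx A) J) -JA -!mulmxA AXc mulmx1.
move: JX; rewrite -{1 2 4}[X]submxK map_block_mx /J !mulmx_block.
rewrite !mulmx0 !mul0mx !mulmxN !mulNmx !mulmx1 !mul1mx !addr0 !add0r.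
case/eq_block_mx => E1 E2 _ _; rewrite /cplx_mx.
have -> : map_mx (@qa R) (quat_mx X) = ulsubmx X by apply/matrixP => i j; rewrite !mxE.
have -> : map_mx (@qb R) (quat_mx X) = ursubmx X by apply/matrixP => i j; rewrite !mxE.
by rewrite -map_mxN -E1 conjK -{2}E2 conjK submxK.
Qed.

Record SL := MkSL { SLval :> M; SLP : detH SLval == 1 }.
HB.instance Definition _ := [isSub for SLval].
HB.instance Definition _ := [Choice of SL by <:].

Lemma det1_subproof : detH 1%:M == 1.
Proof. by rewrite /detH cplx_mx1 det1. Qed.
Lemma detM_subproof (g h : SL) : detH (g *m h) == 1.
Proof.
by rewrite /detH cplx_mxM det_mulmx -!/(detH _) (eqP (SLP g)) (eqP (SLP h)) mulr1.
Qed.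
Lemma cplxV_subproof (g : SL) :
  cplx_mx (quat_mx (invmx (cplx_mx g))) = invmx (cplx_mx g).
Proof.
apply: (@quat_mxK g); apply: mulVmx.
by rewrite unitmxE -/(detH g) (eqP (SLP g)) unitr1.
Qed.
Lemma detV_subproof (g : SL) : detH (quat_mx (invmx (cplx_mx g))) == 1.
Proof.
by rewrite /detH cplxV_subproof det_inv -/(detH g) (eqP (SLP g)) invr1.
Qed.

Definition oneSL := MkSL det1_subproof.
Definition mulSL g h := MkSL (detM_subproof g h).
Definition invSL g := MkSL (detV_subproof g).

Lemma mulSLA : associative mulSL.
Proof. by move=> f g h; apply: val_inj; rewrite /= mulmxA. Qed.
Lemma mul1SL : left_id oneSL mulSL.
Proof. by move=> f; apply: val_inj; rewrite /= mul1mx. Qed.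
Lemma mulSL1 : right_id oneSL mulSL.
Proof. by move=> f; apply: val_inj; rewrite /= mulmx1. Qed.
Lemma mulVSL : left_inverse oneSL invSL mulSL.
Proof.
move=> f; apply/val_inj/cplx_mx_inj; rewrite /= cplx_mxM cplxV_subproof cplx_mx1.
by rewrite mulVmx // unitmxE -/(detH f) (eqP (SLP f)) unitr1.
Qed.
Lemma mulSLV : right_inverse oneSL invSL mulSL.
Proof.
move=> f; apply/val_inj/cplx_mx_inj; rewrite /= cplx_mxM cplxV_subproof cplx_mx1.
by rewrite mulmxV // unitmxE -/(detH f) (eqP (SLP f)) unitr1.
Qed.
HB.instance Definition _ := isGroup.Build SL mulSLA mul1SL mulSL1 mulVSL mulSLV.

Lemma detN_subproof (g : SL) : detH (- SLval g) == 1.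
Proof.
rewrite /detH cplx_mxN -scaleN1r detZ -/(detH g) (eqP (SLP g)) mulr1.
by rewrite -signr_odd oddD addbb expr0.
Qed.
Definition oppSL g := MkSL (detN_subproof g).

Definition psl_rel (g h : SL) : bool := (g == h) || (g == oppSL h).

Lemma oppSLK : involutive oppSL.
Proof. by move=> g; apply: val_inj; rewrite /= opprK. Qed.

Lemma psl_rel_equiv : equiv_class_of psl_rel.
Proof.
split=> [g|g h|h g f]; first by rewrite /psl_rel eqxx.
  by rewrite /psl_rel eq_sym; congr orb; apply/eqP/eqP => ->; rewrite oppSLK.
case/orP => /eqP -> => /orP[]/eqP->; rewrite /psl_rel ?oppSLK eqxx ?orbT //.
Qed.
Canonical psl_equiv := EquivRelPack psl_rel_equiv.

Definition PSL := {eq_quot psl_rel}%qT.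
HB.instance Definition _ := Choice.on PSL.
HB.instance Definition _ := EqQuotient.on PSL.
End SL.

Section PSLgroup.
Variables (R : realType) (n : nat).
Local Notation SL := (SL R n).
Local Notation PSL := (PSL R n).
Local Open Scope quotient_scope.
Implicit Types (g h : SL) (a b c : PSL).

Definition psl g : PSL := \pi g.

Lemma pslP g h : reflect (g = h \/ g = oppSL h) (psl g == psl h).
Proof.
rewrite /psl piE /psl_rel.
apply: (iffP orP) => -[].
- by move/eqP; left.
- by move/eqP; right.
- by move=> ->; left.
- by move=> ->; right.
Qed.

Lemma pslN g : psl (oppSL g) = psl g.
Proof. by apply/eqP/pslP; right. Qed.

Lemma repr_psl g : repr (psl g) = g \/ repr (psl g) = oppSL g.
Proof. by apply/pslP; rewrite /psl reprK. Qed.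

Definition mulPSL a b := psl (mulSL (repr a) (repr b)).
Definition invPSL a := psl (invSL (repr a)).

Lemma mulSLNl g h : mulSL (oppSL g) h = oppSL (mulSL g h).
Proof. by apply: val_inj; rewrite /= mulNmx. Qed.
Lemma mulSLNr g h : mulSL g (oppSL h) = oppSL (mulSL g h).
Proof. by apply: val_inj; rewrite /= mulmxN. Qed.

Lemma mulPSLE g h : mulPSL (psl g) (psl h) = psl (mulSL g h).
Proof.
rewrite /mulPSL; case: (repr_psl g) (repr_psl h) => -> [] -> //;
  by rewrite ?mulSLNl ?mulSLNr ?oppSLK ?pslN.
Qed.

Lemma pslK a : psl (repr a) = a. Proof. exact: reprK. Qed.

Lemma mulPSLA : associative mulPSL.
Proof.
by move=> a b c; rewrite -[a]pslK -[b]pslK -[c]pslK !mulPSLE mulSLA.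
Qed.
Lemma mul1PSL : left_id (psl (oneSL R n)) mulPSL.
Proof. by move=> a; rewrite -[a]pslK mulPSLE mul1SL. Qed.
Lemma mulPSL1 : right_id (psl (oneSL R n)) mulPSL.
Proof. by move=> a; rewrite -[a]pslK mulPSLE mulSL1. Qed.
Lemma mulVPSL : left_inverse (psl (oneSL R n)) invPSL mulPSL.
Proof. by move=> a; rewrite -{2}[a]pslK mulPSLE mulVSL. Qed.
Lemma mulPSLV : right_inverse (psl (oneSL R n)) invPSL mulPSL.
Proof. by move=> a; rewrite -{1}[a]pslK mulPSLE mulSLV. Qed.
HB.instance Definition _ :=
  isGroup.Build PSL mulPSLA mul1PSL mulPSL1 mulVPSL mulPSLV.

End PSLgroup.

Section Proj.
Variables (R : realType) (n : nat).
Local Notation H := (quat R).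
Local Open Scope quotient_scope.

Definition rscale (v : 'cV[H]_n.+1) (a : H) : 'cV[H]_n.+1 := \col_i (v i 0 * a).

Record nzvec := NZVec { nzval :> 'cV[H]_n.+1; nzvalP : nzval != 0 }.
HB.instance Definition _ := [isSub for nzval].
HB.instance Definition _ := [Choice of nzvec by <:].
HB.instance Definition _ := Topological.copy nzvec (initial_topology nzval).

Definition proj_rel (z w : nzvec) : bool :=
  `[< exists2 a : H, a != 0 & nzval z = rscale w a >].

Lemma rscale1 v : rscale v 1 = v.
Proof. by apply/colP => i; rewrite mxE mulr1. Qed.
Lemma rscaleM v a b : rscale (rscale v a) b = rscale v (a * b).
Proof. by apply/colP => i; rewrite !mxE mulrA. Qed.
Lemma rscale0 v : rscale v 0 = 0.
Proof. by apply/colP => i; rewrite !mxE mulr0. Qed.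

Lemma proj_rel_equiv : equiv_class_of proj_rel.
Proof.
have sym z w : proj_rel z w -> proj_rel w z.
  move=> /asboolP[a a0 zwa]; apply/asboolP; exists a^-1.
    by rewrite -unitqE unitrV unitqE.
  by rewrite zwa rscaleM divrr ?unitqE // rscale1.
split=> [z|z w|z w y].
- by apply/asboolP; exists 1; rewrite ?oner_eq0 ?rscale1.
- by apply/idP/idP; apply: sym.
- move=> /asboolP[a a0 zwa] /asboolP[b b0 wyb]; apply/asboolP; exists (b * a).
    by rewrite -unitqE unitrMr ?unitqE.
  by rewrite zwa wyb rscaleM.
Qed.
Canonical proj_equiv := EquivRelPack proj_rel_equiv.

Definition PH := quotient_topology {eq_quot proj_rel}.
HB.instance Definition _ := Topological.on PH.
HB.instance Definition _ := Quotient.on PH.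

Definition proj_pt (z : nzvec) : PH := \pi z.

Lemma proj_ptP (z w : nzvec) :
  proj_pt z = proj_pt w <-> exists2 a : H, a != 0 & nzval z = rscale w a.
Proof.
rewrite -[proj_pt z = _]/(\pi_({eq_quot proj_rel}) z = \pi w).
split; first by move=> /eqP; rewrite piE => /asboolP.
by move=> zw; apply/eqP; rewrite piE; apply/asboolP.
Qed.

Lemma proj_ptK (p : PH) : proj_pt (repr p) = p.
Proof. exact: reprK. Qed.

Lemma open_PHE (U : set PH) : open U = open (proj_pt @^-1` U).
Proof. by []. Qed.

End Proj.
Arguments nzval {R n} _.
Arguments proj_pt {R n} _.

Section QuatCvg.
Variable R : realType.
Local Notation H := (quat R).
Implicit Types x y : H.

Lemma quat_normM x y : `|x * y| = `|x| * `|y|.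
Proof. exact: normqM. Qed.

Lemma conjqB x y : conjq (x - y) = conjq x - conjq y.
Proof.
by case: x y => [a b] [c d]; congr Quat; rewrite /= ?rmorphB //= opprB opprK addrC.
Qed.

Lemma sqnormq_conj x : sqnormq (conjq x) = sqnormq x.
Proof. by case: x => -[a b] [c d]; rewrite /sqnormq /= !sqrrN. Qed.

Lemma quat_norm_conj x : `|conjq x| = `|x|.
Proof. by rewrite !quat_normE /normq sqnormq_conj. Qed.

Lemma sqnormqE x : sqnormq x = `|x| ^+ 2.
Proof. by rewrite quat_normE sqr_sqrtr ?sqnormq_ge0. Qed.

Lemma cvg_mulq (T : Type) (F : set_system T) (FF : Filter F) (f g : T -> H) (a b : H) :
  f @ F --> a -> g @ F --> b -> (f t * g t) @[t --> F] --> a * b.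
Proof.
move=> fa gb; apply/subr_cvg0/norm_cvg0P.
have fa0 : `|f t - a| @[t --> F] --> (0 : R) by apply/norm_cvg0P/subr_cvg0.
have gb0 : `|g t - b| @[t --> F] --> (0 : R) by apply/norm_cvg0P/subr_cvg0.
have hb : `|f t - a| * `|g t| + `|a| * `|g t - b| @[t --> F] --> (0 : R).
  rewrite [X in _ --> X](_ : _ = 0 * `|b| + `|a| * 0); last first.
    by rewrite mul0r mulr0 addr0.
  by apply: cvgD; apply: cvgM => //; [exact: cvg_norm | exact: cvg_cst].
have fgh : \forall t \near F,
    0 <= `|f t * g t - a * b| <= `|f t - a| * `|g t| + `|a| * `|g t - b|.
  apply: nearW => t; rewrite normr_ge0 /= -!quat_normM.
  have -> : f t * g t - a * b = (f t - a) * g t + a * (g t - b).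
    by rewrite mulrBl mulrBr addrA subrK.
  exact: ler_normD.
exact: (squeeze_cvgr fgh (cvg_cst _) hb).
Qed.

Lemma cvg_conjq (T : Type) (F : set_system T) (FF : Filter F) (f : T -> H) (a : H) :
  f @ F --> a -> conjq (f t) @[t --> F] --> conjq a.
Proof.
move=> /subr_cvg0/norm_cvg0P fa; apply/subr_cvg0/norm_cvg0P.
apply: cvg_trans fa; apply: near_eq_cvg; near=> t => /=.
by rewrite -conjqB quat_norm_conj.
Unshelve. all: by end_near. Qed.

End QuatCvg.

Section ProjTopology.
Variables (R : realType) (n : nat).
Local Notation H := (quat R).
Local Notation nzvec := (nzvec R n).
Local Notation PH := (PH R n).
Local Open Scope quotient_scope.
Implicit Types (z w : nzvec) (p q : PH).

Definition hnorm2 (v : 'cV[H]_n.+1) : R := \sum_i sqnormq (v i 0).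

(* the matrix z z^* / |z|^2 of the orthogonal projection onto the line z H *)
Definition proj_mx (v : 'cV[H]_n.+1) : 'M[H]_n.+1 :=
  \matrix_(i, j) ((hnorm2 v)^-1 *: (v i 0 * conjq (v j 0))).

Lemma hnorm2_gt0 z : 0 < hnorm2 z.
Proof.
rewrite lt_neqAle sumr_ge0 ?andbT; last by move=> i _; exact: sqnormq_ge0.
apply: contra (nzvalP z); rewrite eq_sym psumr_eq0; last first.
  by move=> i _; exact: sqnormq_ge0.
move=> /allP z0; apply/eqP/colP => i; apply/eqP; rewrite mxE -sqnormq_eq0.
by apply: (implyP (z0 i _)) => //; rewrite mem_index_enum.
Qed.

Lemma proj_mx_rscale (v : 'cV[H]_n.+1) (a : H) : a != 0 ->
  proj_mx (rscale v a) = proj_mx v.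
Proof.
move=> a0; have sa0 : sqnormq a != 0 by rewrite sqnormq_eq0.
rewrite /proj_mx; have -> : hnorm2 (rscale v a) = hnorm2 v * sqnormq a.
  by rewrite /hnorm2 mulr_suml; apply: eq_bigr => i _; rewrite mxE sqnormqM.
apply/matrixP => i j; rewrite !mxE conjqM mulrA -(mulrA (v i 0)) mulqJ.
have -> : Quat (sqnormq a)%:C%C 0 = sqnormq a *: (1 : H).
  by congr Quat; rewrite /= ?mulr1 ?mulr0.
by rewrite -scaleqAr -scaleqAl mulr1 scalerA invfM -mulrA mulVf // mulr1.
Qed.

Definition PH_mx p : 'M[H]_n.+1 := proj_mx (repr p : nzvec).

Lemma PH_mxE z : PH_mx (proj_pt z) = proj_mx z.
Proof.
rewrite /PH_mx.
have /proj_ptP[a a0 ->] : proj_pt (repr (proj_pt z)) = proj_pt z.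
  exact: proj_ptK.
exact: proj_mx_rscale.
Qed.

Lemma proj_mx_id z : proj_mx z *m z = z.
Proof.
apply/colP => i; rewrite mxE.
under eq_bigr => j _ do rewrite mxE -scaleqAl -mulrA mulJq.
rewrite -scaler_sumr -mulr_sumr.
have -> : \sum_j Quat (sqnormq (nzval z j 0))%:C%C 0 = hnorm2 z *: (1 : H).
  rewrite /hnorm2 scaler_suml; apply: eq_bigr => j _.
  by congr Quat; rewrite /= ?mulr1 ?mulr0.
by rewrite -scaleqAr mulr1 scalerA mulVf ?scale1r // gt_eqF // hnorm2_gt0.
Qed.

Lemma proj_mx_span (v w : 'cV[H]_n.+1) : exists a : H, proj_mx w *m v = rscale w a.
Proof.
exists ((hnorm2 w)^-1 *: \sum_j conjq (w j 0) * v j 0).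
apply/colP => i; rewrite !mxE -scaleqAr mulr_sumr scaler_sumr.
by apply: eq_bigr => j _; rewrite mxE -scaleqAl mulrA.
Qed.

(* |P_z - P_w| < e implies that P_w z, a vector of w H, is close to z *)
Lemma PH_mx_open (U : set PH) z : open U -> U (proj_pt z) ->
  exists2 e : R, 0 < e & forall q, ball (PH_mx (proj_pt z)) e (PH_mx q) -> U q.
Proof.
rewrite open_PHE => -[V oV VU] Uz.
have Vz : (@nzval R n @^-1` V) z by rewrite VU.
have [i0 zi0] : exists i, nzval z i 0 != 0.
  apply/existsP; apply: contraT => /existsPn z0; have /eqP[] := nzvalP z.
  by apply/colP => i; rewrite mxE; apply/eqP; rewrite -[_ == _]negbK z0.
have /nbhs_ballP[d /= d0 dV] : nbhs (nzval z) V by exact: open_nbhs_nbhs.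
pose S := 1 + \sum_j `|nzval z j 0|.
have S0 : 0 < S by rewrite ltr_pwDl ?ltr01 // sumr_ge0.
pose d' := Num.min d `|nzval z i0 0|.
have d'0 : 0 < d' by rewrite lt_min d0 normr_gt0.
exists (d' / S); first exact: divr_gt0.
move=> q; rewrite -(proj_ptK q) !PH_mxE; move: (repr q : nzvec) => w [_ bq].
have [a Ea] := proj_mx_span z w.
have close i : `|nzval z i 0 - rscale w a i 0| < d'.
  rewrite -Ea -{1}[nzval z]proj_mx_id !mxE -sumrB.
  under eq_bigr => j _ do rewrite -mulrBl.
  apply: le_lt_trans (ler_norm_sum _ _ _) _.
  apply: (@le_lt_trans _ _ (\sum_j d' / S * `|nzval z j 0|)).
    apply: ler_sum => j _; rewrite quat_normM ler_wpM2r //.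
    by have := bq i j; rewrite -ball_normE /= => /ltW.
  rewrite -mulr_sumr mulrAC ltr_pdivrMr // ltr_pM2l // /S.
  by rewrite ltrDr ltr01.
have a0 : a != 0.
  apply/eqP => a0; have := close i0; rewrite a0 rscale0 mxE subr0.
  by rewrite lt_min ltxx andbF.
have wa0 : rscale w a != 0.
  apply/eqP => wa0; have := close i0; rewrite wa0 mxE subr0.
  by rewrite lt_min ltxx andbF.
have <- : proj_pt (NZVec wa0) = proj_pt w by apply/proj_ptP; exists a.
have : (@nzval R n @^-1` V) (NZVec wa0); last by rewrite VU.
apply: dV; split => // i j.
rewrite (ord1 j) -ball_normE /=; apply: lt_le_trans (close i) _.
by rewrite ge_min lexx.
Qed.

Lemma cvg_coord m k (v : 'M[H]_(m, k)) i j :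
  (fun x : 'M[H]_(m, k) => x i j) @ v --> v i j.
Proof.
move=> A /nbhs_ballP[e /= e0 eA].
apply: (@filterS _ (nbhs v) _ (ball v e)); last exact: nbhsx_ballx.
by move=> x [_ xv]; exact/eA/xv.
Qed.

Lemma cvg_proj_mx (T : Type) (F : set_system T) (FF : Filter F)
    (f : T -> nzvec) z :
  (forall i, (nzval (f t) i 0) @[t --> F] --> nzval z i 0) ->
  proj_mx (f t) @[t --> F] --> proj_mx z.
Proof.
move=> cc A /nbhs_ballP[e /= e0 eA].
have nc : hnorm2 (f t) @[t --> F] --> hnorm2 z.
  apply: cvg_big => [|i _]; first exact: add_continuous.
  under eq_fun do rewrite sqnormqE expr2; rewrite sqnormqE expr2.
  by apply: cvgM; apply: cvg_norm; exact: cc.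
have ec i j : proj_mx (f t) i j @[t --> F] --> proj_mx z i j.
  under eq_fun do rewrite mxE; rewrite mxE.
  apply: cvgZ; first by apply: cvgV => //; rewrite gt_eqF // hnorm2_gt0.
  by apply: cvg_mulq; [exact: cc|apply: cvg_conjq; exact: cc].
have : \forall t \near F, forall ij : 'I_n.+1 * 'I_n.+1,
    ball (proj_mx z ij.1 ij.2) e (proj_mx (f t) ij.1 ij.2).
  by apply: filter_forall => ij; have /cvg_ballP := ec ij.1 ij.2; exact.
by apply: filterS => w bw; apply: eA; split => // i j; exact: (bw (i, j)).
Qed.

Lemma proj_mx_continuous : continuous (fun z => proj_mx z).
Proof.
move=> z; apply: (@cvg_proj_mx _ (nbhs z) (nbhs_filter z) id) => i.
apply: (cvg_comp _ _ _ (@cvg_coord _ _ (nzval z) i 0)).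
exact: initial_continuous.
Qed.

Lemma PH_mx_continuous : continuous PH_mx.
Proof.
apply/quotient_continuous => z.
rewrite /continuous_at [X in X @ _ --> _](_ : _ = (fun z : nzvec => proj_mx z)).
  rewrite [X in _ --> X](_ : _ = proj_mx z); first exact: proj_mx_continuous.
  exact: PH_mxE.
by apply/funext => w; exact: PH_mxE.
Qed.

Let W := initial_topology PH_mx.

Lemma PH_nbhsE : @nbhs PH PH = @nbhs W W.
Proof.
rewrite predeq2E => p A; split.
- rewrite nbhsE => -[U [oU Up] UA].
  move: Up; rewrite -(proj_ptK p) => Up.
  have [e e0 eU] := PH_mx_open oU Up.
  apply: (@filterS _ (nbhs (proj_pt (repr p) : W)) _ (ball (proj_pt (repr p) : W) e)).
    by move=> q bq; apply/UA/eU.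
  exact: nbhsx_ballx.
- rewrite {1}nbhsE => -[_ [[V oV <-] Vp] VA]; apply: filterS VA _.
  by apply: PH_mx_continuous; exact: open_nbhs_nbhs.
Qed.

Lemma PH_nbhs_entE : @nbhs PH PH = nbhs_ (@entourage W).
Proof. by rewrite PH_nbhsE nbhs_entourageE. Qed.

(* PH carries the quotient topology, and the uniformity (hence the notion of
   uniform convergence) of the metric that compares orthogonal projectors; on a
   compact Hausdorff space the compatible uniformity is unique. *)
HB.instance Definition _ := Nbhs_isUniform_mixin.Build PH
  (@entourage_filter W) (@entourage_diagonal_subproof W)
  (@entourage_inv_subproof W) (@entourage_split_ex_subproof W) PH_nbhs_entE.

HB.instance Definition _ := Uniform_isPseudoMetric.Build R PH
  (@ball_center_subproof R W) (@ball_sym_subproof R W)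
  (@ball_triangle_subproof R W) (@entourageE_subproof R W).

Lemma PH_ballE p (e : R) q : ball p e q = ball (PH_mx p) e (PH_mx q).
Proof. by []. Qed.

End ProjTopology.

Section ProjSpan.
Variables (R : realType) (n : nat).
Local Notation H := (quat R).
Local Notation PH := (PH R n).

Definition right_subspace (V : set 'cV[H]_n.+1) : Prop :=
  [/\ V 0, forall v w, V v -> V w -> V (v + w)
    & forall v a, V v -> V (rscale v a)].

(* the whole space is obtained for V = setT, the empty set for V = 0 *)
Definition projectivization (V : set 'cV[H]_n.+1) : set PH :=
  [set p | exists2 z : nzvec R n, V (nzval z) & proj_pt z = p].

Definition proj_subspace (S : set PH) : Prop :=
  exists2 V, right_subspace V & S = projectivization V.

Definition proj_span (S : set PH) : set PH := smallest proj_subspace S.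

Lemma projectivizationP (V : set 'cV[H]_n.+1) (z : nzvec R n) :
  right_subspace V -> projectivization V (proj_pt z) <-> V (nzval z).
Proof.
move=> [_ _ VZ]; split=> [[w Vw /esym/proj_ptP[a _ ->]]|Vz]; first exact: VZ.
by exists z.
Qed.

Lemma proj_span_subspace (S : set PH) : proj_subspace (proj_span S).
Proof.
exists [set v | forall V, right_subspace V -> S `<=` projectivization V -> V v].
  split=> [V [] //|v w Vv Vw V hV SV|v a Vv V hV SV].
    by have [_ VD _] := hV; apply: VD; [exact: Vv|exact: Vw].
  by have [_ _ VZ] := hV; apply: VZ; exact: Vv.
apply/seteqP; split=> p.
  move=> Sp; exists (repr p : nzvec R n); last exact: proj_ptK.
  move=> V hV SV; apply/(projectivizationP _ hV); rewrite proj_ptK.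
  by apply: Sp; split => //; exists V.
move=> [z hz <-] _ [[V hV ->] SV].
by apply/projectivizationP => //; exact: hz.
Qed.

Lemma delta_neq0 (s : 'I_n.+1) : delta_mx s 0 != 0 :> 'cV[H]_n.+1.
Proof.
by apply/eqP => /colP/(_ s)/eqP; rewrite !mxE !eqxx oner_eq0.
Qed.

Definition std_pt (s : 'I_n.+1) : PH := proj_pt (NZVec (delta_neq0 s)).

End ProjSpan.

Section Action.
Variables (R : realType) (n : nat).
Local Notation H := (quat R).
Local Notation SL := (SL R n).
Local Notation PSL := (PSL R n).
Local Notation PH := (PH R n).
Local Open Scope quotient_scope.

Lemma SL_mulmx_neq0 (g : SL) (z : nzvec R n) : SLval g *m nzval z != 0.
Proof.
apply: contra (nzvalP z) => /eqP gz; rewrite -[nzval z]mul1mx.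
by rewrite -[1%:M]/(SLval (oneSL R n)) -(mulVSL g) /= -mulmxA gz mulmx0.
Qed.

Definition actSL (g : SL) (z : nzvec R n) : nzvec R n :=
  NZVec (SL_mulmx_neq0 g z).

Definition act (c : PSL) (p : PH) : PH :=
  proj_pt (actSL (repr c) (repr p : nzvec R n)).

Lemma mulmx_rscale (A : 'M[H]_n.+1) v a : A *m rscale v a = rscale (A *m v) a.
Proof.
apply/colP => i; rewrite !mxE mulr_suml; apply: eq_bigr => j _.
by rewrite mxE mulrA.
Qed.

Lemma actE (g : SL) (z : nzvec R n) :
  act (psl g) (proj_pt z) = proj_pt (actSL g z).
Proof.
have /proj_ptP[a a0 za] : proj_pt (repr (proj_pt z)) = proj_pt z.
  exact: proj_ptK.
apply/proj_ptP; case: (repr_psl g) => Eg.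
  by exists a => //=; rewrite Eg za mulmx_rscale.
exists (- a); first by rewrite oppr_eq0.
rewrite /= Eg za mulmx_rscale /= mulNmx.
by apply/colP => i; rewrite !mxE mulNr mulrN.
Qed.

Lemma act1 p : act 1%g p = p.
Proof.
rewrite -(proj_ptK p) -[1%g]/(psl (oneSL R n)) actE; apply/proj_ptP.
by exists 1; rewrite ?oner_eq0 //= mul1mx rscale1.
Qed.

Lemma actM (b c : PSL) p : act (b * c)%g p = act b (act c p).
Proof.
rewrite -(proj_ptK p) -[b]pslK -[c]pslK.
rewrite -[(_ * _)%g]/(mulPSL _ _) mulPSLE !actE; apply/proj_ptP.
by exists 1; rewrite ?oner_eq0 //= mulmxA rscale1.
Qed.

End Action.

Definition normal_family (X : topologicalType) (Y : uniformType)
    (F : set (X -> Y)) : Prop :=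
  forall u : nat -> X -> Y, (forall i, F (u i)) ->
  exists2 phi : nat -> nat, {homo phi : i j / (i < j)%N} &
  exists f : X -> Y, {family compact, u \o phi @ \oo --> f}.

Section Equicontinuity.
Variables (R : realType) (n : nat).
Local Notation PSL := (PSL R n).
Local Notation PH := (PH R n).

Definition Eq (G : set PSL) : set PH :=
  [set z | exists U : set PH, [/\ open U, U z &
    normal_family [set f : U -> PH |
      exists2 g, G g & f = (fun x : U => act g (set_val x))]]].

Definition cyclic_subgroup (c : PSL) : set PSL :=
  [set h | exists k : nat, h = (c ^+ k)%g \/ h = (c ^- k)%g].

End Equicontinuity.

Section Parabolic.
Variables (R : realType) (n : nat).
Local Notation H := (quat R).
Local Notation PSL := (PSL R n).

Definition right_eigenvalue (A : 'M[H]_n.+1) (a : H) : Prop :=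
  exists2 v : 'cV[H]_n.+1, v != 0 & A *m v = rscale v a.

Definition diagonalizableH (A : 'M[H]_n.+1) : Prop :=
  exists P Q D : 'M[H]_n.+1,
    [/\ P *m Q = 1%:M, Q *m P = 1%:M, is_diag_mx D & A = P *m D *m Q].

Definition parabolic (c : PSL) : Prop :=
  (forall g, psl g = c -> ~ diagonalizableH (SLval g)) /\
  (forall g a, psl g = c -> right_eigenvalue (SLval g) a -> `|a| = 1).

End Parabolic.

Section Jordan.
Variable R : realType.
Local Notation H := (quat R).

Definition jordan_block (lam : R[i]) (k : nat) : 'M[H]_k :=
  \matrix_(i, j) if i == j then quatC lam
                 else if (j == i.+1 :> nat) then 1 else 0.

(* [lam i j] is the eigenvalue of the j-th block of size [k i]; indices start
   at 2 for i and at 1 for j. *)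
Definition jordan_mx (m : nat) (k l : nat -> nat) (d : 'rV[R[i]]_(k 1%N))
    (lam : nat -> nat -> R[i]) :
    'M[H]_(k 1 + \sum_(i < m.-1) \sum_(j < l i.+2) k i.+2)%N :=
  block_mx (diag_mx (map_mx (@quatC R) d)) 0 0
    (\mxdiag_(i < m.-1) \mxdiag_(j < l i.+2)
       jordan_block (lam i.+2 j.+1) (k i.+2)).

Lemma jordan_dim m (k l : nat -> nat) :
  (\sum_(i < m.-1) \sum_(j < l i.+2) k i.+2)%N =
  (\sum_(2 <= i < m.+1) l i * k i)%N.
Proof.
rewrite -[RHS]/(\sum_(0 + 2 <= i < m.+1) l i * k i)%N.
rewrite big_addn big_mkord subSS subn1.
by apply: eq_bigr => i _; rewrite sum_nat_const card_ord addn2.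
Qed.

End Jordan.

(* Main.v *)
(* Let K be the size of the largest Jordan blocks. The powers of the Jordan
   form have entries mu^(k-r) C(k, r), with C(k, r) extended to all integers k;
   since |mu| = 1, the matrix of moduli of a block depends only on its size.

   Outside the span L: dividing the k-th power by the sum of the |C(k, r)| with
   r < K bounds all entries, so any sequence of powers has a subsequence whose
   normalized matrices converge to some A. On each block A is upper triangular
   Toeplitz, and it does not vanish on a maximal block. Hence A x <> 0 as soon
   as the last coordinate of x in some maximal block is nonzero, i.e. off L,
   and the projective maps converge to that of A uniformly on compact sets.

   On L: such limits take their values in the span E of the first vectors of
   the maximal blocks. For z in L, a perturbation of size O(1/N) of the last
   coordinates of the maximal blocks cancels the E-components of the N-th power
   at z, because the coefficient C(N, K-1) of these coordinates dominates. So
   points converging to z, which can be taken off L, are mapped far from E, and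
   the convergence is not uniform near z. *)

Require Import Defs.
From HB Require Import structures.
From mathcomp Require Import all_boot all_order all_algebra.
From mathcomp Require Import all_classical all_reals all_analysis.
From mathcomp Require Import complex.
From mathcomp Require Import ring lra zify.

Set Implicit Arguments.
Unset Strict Implicit.
Unset Printing Implicit Defensive.

Import Order.TTheory GRing.Theory Num.Theory.
Import numFieldNormedType.Exports.

Local Open Scope classical_set_scope.
Local Open Scope ring_scope.

(** * Subsequences and compactness *)

Section Sequences.

(** If a filter on this set does not cluster at [x], one of its members misses a neighbourhood of
    [x], which contains a tail of [s]. The filter then lives on finitely many terms, a compact
    set. *)
Lemma compact_cvg_range (X : topologicalType) (s : nat -> X) (x : X) :
  s @ \oo --> x -> compact (x |` range s).
Proof.
move=> sx F FF FA.
have [clx|/existsNP[B /existsNP[V /not_implyP[FB /not_implyP[Vx nBV]]]]] :=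
  pselect (cluster F x); first by exists x; split => //; left.
have BV : B `&` V = set0.
  by apply/eqP; apply: contra_notT nBV => /set0P.
have [N _ NV] := sx _ Vx.
have cD : compact (s @` `I_N) by apply/finite_compact/finite_image/finite_II.
have : F (s @` `I_N).
  apply: filterS (filterI FA FB) => y [[->|[i _ <-]] By].
    by have : (B `&` V) x by [split => //; exact: nbhs_singleton]; rewrite BV.
  exists i => //=; rewrite ltnNge; apply/negP => Ni.
  by have : (B `&` V) (s i) by [split => //; exact: NV]; rewrite BV.
by move=> /(cD F FF)[y [[i _ <-] cly]]; exists (s i); split => //; right; exists i.
Qed.

Lemma homo_ltn_ge (f : nat -> nat) k : {homo f : i j / (i < j)%N} -> (k <= f k)%N.
Proof. by move=> fi; elim: k => // k IH; apply: leq_ltn_trans IH _; exact: fi. Qed.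

Lemma homo_ltn_cvg (f : nat -> nat) : {homo f : i j / (i < j)%N} ->
  f @ \oo --> \oo.
Proof.
move=> fi A [N _ NA]; exists N => // m Nm; apply: NA => /=.
exact: leq_trans Nm (homo_ltn_ge m fi).
Qed.

(** There are finitely many coordinates, so Bolzano-Weierstrass is applied to one after another,
    each time refining the subsequence found so far. *)
Lemma bounded_subseq (R : realType) (I : eqType) (r : seq I) (u : nat -> I -> R) :
  (forall k i, `|u k i| <= 1) ->
  exists2 phi : nat -> nat, {homo phi : i j / (i < j)%N} &
  forall i, i \in r -> cvgn (fun k => u (phi k) i).
Proof.
move=> u1; elim: r => [|a r [phi hphi cphi]]; first by exists id.
have [psi hpsi cpsi] : exists2 psi : nat -> nat,
    increasing_seq psi & cvgn ((fun k => u (phi k) a) \o psi).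
  apply: bolzano_weierstrass; exists 1; split=> // x x1 k _.
  exact: le_trans (u1 _ _) (ltW x1).
have hpsi' : {homo psi : i j / (i < j)%N}.
  by move=> i j; rewrite !ltnNge => /negP ij; apply/negP => /=; rewrite -leEnat hpsi.
exists (phi \o psi) => [i j ij|i]; first exact/hphi/hpsi'.
rewrite inE => /predU1P[->//|/cphi ci].
have /= := cvg_comp _ _ (homo_ltn_cvg hpsi') ci.
exact: cvgP.
Qed.

End Sequences.

Section QuatSequences.
Variable R : realType.
Local Notation H := (quat R).

Lemma quat_norm_parts (x : H) :
  [/\ `|complex.Re (qa x)| <= `|x|, `|complex.Im (qa x)| <= `|x|,
      `|complex.Re (qb x)| <= `|x| & `|complex.Im (qb x)| <= `|x|].
Proof.
rewrite !quat_normE /normq -!sqrtr_sqr /sqnormq.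
case: x => -[a b] [c d] /=.
have := (sqr_ge0 a, sqr_ge0 b, sqr_ge0 c, sqr_ge0 d) => -[[[a0 b0] c0] d0].
by split; apply: ler_wsqrtr; rewrite /sqnormq /=; lra.
Qed.

Lemma quat_norm_le (x : H) :
  `|x| <= `|complex.Re (qa x)| + `|complex.Im (qa x)|
        + `|complex.Re (qb x)| + `|complex.Im (qb x)|.
Proof.
rewrite quat_normE /normq -(@ler_pXn2r _ 2) ?nnegrE ?sqrtr_ge0 ?addr_ge0 //.
rewrite sqr_sqrtr ?sqnormq_ge0 // /sqnormq.
case: x => -[a b] [c d] /=.
rewrite -(real_normK (num_real a)) -(real_normK (num_real b)).
rewrite -(real_normK (num_real c)) -(real_normK (num_real d)).
move: (normr_ge0 a) (normr_ge0 b) (normr_ge0 c) (normr_ge0 d).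
move: `|a| `|b| `|c| `|d| => a' b' c' d' *; nra.
Qed.

Lemma mx_bounded_subseq (m n : nat) (A : nat -> 'M[H]_(m, n)) :
  (forall k i j, `|A k i j| <= 1) ->
  exists2 phi : nat -> nat, {homo phi : i j / (i < j)%N} &
  exists B : 'M[H]_(m, n), forall i j, (A (phi k) i j @[k --> \oo] --> B i j).
Proof.
move=> A1.
(* Compactness is reduced to the reals: a quaternion is read as its four real components. *)
pose part (t : 'I_4) (x : H) := nth 0 [:: complex.Re (qa x); complex.Im (qa x);
                                   complex.Re (qb x); complex.Im (qb x)] t.
have part_le t x : `|part t x| <= `|x|.
  by have [] := quat_norm_parts x; case: t => -[|[|[|[|]]]].
have := @bounded_subseq R _ (enum {: 'I_m * 'I_n * 'I_4})
  (fun k t => part t.2 (A k t.1.1 t.1.2)).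
case=> [k i|phi hphi cphi]; first exact: le_trans (part_le _ _) (A1 _ _ _).
exists phi => //.
have /choice[l lE] : forall t : 'I_m * 'I_n * 'I_4, exists l : R,
   part t.2 (A (phi k) t.1.1 t.1.2) @[k --> \oo] --> l.
  by move=> t; apply/cvg_ex/cphi; rewrite mem_enum.
exists (\matrix_(i, j) Quat (Complex (l (i, j, inord 0)) (l (i, j, inord 1)))
     (Complex (l (i, j, inord 2)) (l (i, j, inord 3)))) => i j; rewrite mxE.
apply/subr_cvg0/norm_cvg0P.
pose d t k := `|part (inord t) (A (phi k) i j) - l (i, j, inord t)|.
have d0 t : d t k @[k --> \oo] --> (0 : R).
  by apply/norm_cvg0P/subr_cvg0; exact: (lE (i, j, inord t)).
have dd : d 0%N k + d 1%N k + d 2%N k + d 3%N k @[k --> \oo] --> (0 : R).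
  rewrite -[X in _ --> X](addr0 (0 : R)) -[X in _ --> X + _](addr0 (0 : R)).
  rewrite -[X in _ --> X + _ + _](addr0 (0 : R)).
  by apply: cvgD => //; apply: cvgD => //; apply: cvgD.
apply: (squeeze_cvgr _ (cvg_cst (0 : R)) dd).
apply: nearW => k; rewrite normr_ge0 /= (le_trans (quat_norm_le _)) //.
rewrite /d /part !inordK /=; last first; try by [].
by case: (A _ i j) => -[a b] [a' b'].
Qed.

End QuatSequences.

(** * Convergence of projective maps *)

Section ProjCvg.
Variables (R : realType) (n : nat).
Local Notation H := (quat R).
Local Notation PH := (PH R n).
Local Notation nzvec := (nzvec R n).
Local Notation proj_mx := Defs.proj_mx.
Local Open Scope quotient_scope.

Lemma near_neq0 (T : Type) (F : set_system T) (FF : Filter F)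
    (f : T -> 'cV[H]_n.+1) (z : 'cV[H]_n.+1) : z != 0 ->
  (forall i, (f t i 0) @[t --> F] --> z i 0) -> \forall t \near F, f t != 0.
Proof.
move=> z0 cf; have [i0 zi0] : exists i, z i 0 != 0.
  apply/existsP; apply: contraNT z0 => /existsPn z0; apply/eqP/colP => i.
  by rewrite mxE; apply/eqP; rewrite -[_ == _]negbK z0.
have zi0' : 0 < `|z i0 0| by rewrite normr_gt0.
have := cf i0; move=> /cvgrPdist_lt/(_ _ zi0'); apply: filterS => t ft.
by apply/eqP => ft0; move: ft; rewrite ft0 mxE subr0 ltxx.
Qed.

Lemma cvg_proj_mx_col (T : Type) (F : set_system T) (FF : Filter F)
    (f : T -> 'cV[H]_n.+1) (z : 'cV[H]_n.+1) : z != 0 ->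
  (forall i, (f t i 0) @[t --> F] --> z i 0) ->
  proj_mx (f t) @[t --> F] --> proj_mx z.
Proof.
(* [cvg_proj_mx] speaks of nonzero vectors, so [f t] is replaced by the default [zz] wherever it
   vanishes; near the limit this never happens. *)
move=> z0 cf; pose zz := NZVec z0; pose g t : nzvec := insubd zz (f t).
have fg : \forall t \near F, f t = nzval (g t).
  apply: filterS (near_neq0 FF z0 cf) => t ft0.
  by rewrite -[RHS]/(\val (g t)) val_insubd ft0.
have : proj_mx (g t) @[t --> F] --> proj_mx zz.
  apply: cvg_proj_mx => i; apply: cvg_trans (cf i); apply: near_eq_cvg.
  by apply: filterS fg => t ->.
apply: cvg_trans; apply: near_eq_cvg.
by apply: filterS fg => t ->.
Qed.

Lemma cvg_mulmx_col (T : Type) (F : set_system T) (FF : Filter F) (m : nat)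
    (A_ : T -> 'M[H]_(m, n.+1)) (v_ : T -> 'cV[H]_n.+1)
    (A : 'M[H]_(m, n.+1)) (v : 'cV[H]_n.+1) :
  (forall i j, A_ t i j @[t --> F] --> A i j) ->
  (forall i, v_ t i 0 @[t --> F] --> v i 0) ->
  forall i, (A_ t *m v_ t) i 0 @[t --> F] --> (A *m v) i 0.
Proof.
move=> cA cv i; rewrite mxE; under eq_fun do rewrite mxE.
apply: cvg_big => [|j _]; first exact: add_continuous.
exact: cvg_mulq.
Qed.

(** The image line is encoded by its projector, so that [A] may be singular, as limits of normalized
    powers can be. If [A] kills [p], the value is the zero matrix. *)
Definition proj_img (A : 'M[H]_n.+1) (p : PH) : 'M[H]_n.+1 :=
  proj_mx (A *m (repr p : nzvec)).

Lemma proj_img_rscale (A : 'M[H]_n.+1) (p : PH) v a : a != 0 ->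
  v = rscale (repr p : nzvec) a -> proj_img A p = proj_mx (A *m v).
Proof. by move=> a0 ->; rewrite mulmx_rscale proj_mx_rscale. Qed.

Lemma proj_img_pt (A : 'M[H]_n.+1) (z : nzvec) :
  proj_img A (proj_pt z) = proj_mx (A *m z).
Proof.
have /proj_ptP[a a0 E] : proj_pt z = proj_pt (repr (proj_pt z)).
  by rewrite proj_ptK.
exact: proj_img_rscale E.
Qed.

Lemma proj_imgZ (A : 'M[H]_n.+1) (c : R) (p : PH) : c != 0 ->
  proj_img (\matrix_(i, j) (c *: A i j)) p = proj_img A p.
Proof.
move=> c0; rewrite /proj_img.
have -> : (\matrix_(i, j) (c *: A i j)) *m (repr p : nzvec) =
    rscale (A *m (repr p : nzvec)) (c *: (1 : H)).
  apply/colP => i; rewrite !mxE mulr_suml; apply: eq_bigr => j _.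
  by rewrite mxE -scaleqAl -scaleqAr mulr1.
by rewrite proj_mx_rscale // scaler_eq0 negb_or c0 oner_eq0.
Qed.

(* If [z] represents [x], then [PH_mx y *m z] is a representative of [y] that
   depends continuously on [y] near [x]. *)
Lemma proj_img_near (A_ : nat -> 'M[H]_n.+1) (A : 'M[H]_n.+1) (x : PH) (e : R) :
  (forall i j, A_ k i j @[k --> \oo] --> A i j) ->
  A *m (repr x : nzvec) != 0 -> 0 < e ->
  \forall y \near x & k \near \oo, ball (proj_img A y) e (proj_img (A_ k) y).
Proof.
move=> cA Ax0 e0; set z : 'cV[H]_n.+1 := repr x : nzvec in Ax0 *.
have z0 : z != 0 := nzvalP _.
pose V (y : PH) := PH_mx y *m z; pose F := filter_prod (nbhs x) \oo.
have Vx : V x = z by exact: Defs.proj_mx_id.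
have cV i : V t.1 i 0 @[t --> F] --> z i 0.
  rewrite -Vx; apply: cvg_mulmx_col => [j k|j]; last exact: cvg_cst.
  have cP : PH_mx t.1 @[t --> F] --> PH_mx x.
    apply: (@cvg_comp _ _ _ fst (@PH_mx R n) F (nbhs x)); last exact: PH_mx_continuous.
    exact: cvg_fst.
  exact: (cvg_comp _ _ cP (@cvg_coord R _ _ (PH_mx x) j k)).
have V0 : \forall t \near F, V t.1 != 0 by exact: near_neq0 cV.
have VE y B : V y != 0 -> proj_img B y = proj_mx (B *m V y).
  move=> Vy0; have [a Ea] := proj_mx_span z (repr y : nzvec).
  apply: (@proj_img_rscale _ _ _ a) => //.
  by apply: contra_neq Vy0 => a0; rewrite /V /PH_mx Ea a0 rscale0.
have c1 : proj_mx (A *m V t.1) @[t --> F] --> proj_mx (A *m z).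
  apply: cvg_proj_mx_col => // i; apply: cvg_mulmx_col => // *; exact: cvg_cst.
have c2 : proj_mx (A_ t.2 *m V t.1) @[t --> F] --> proj_mx (A *m z).
  apply: cvg_proj_mx_col => // i; apply: cvg_mulmx_col => // j k.
  exact: (cvg_comp _ _ cvg_snd (cA j k)).
have e20 : 0 < e / 2 by rewrite divr_gt0.
move: c1 c2 => /cvg_ballP/(_ _ e20) c1 /cvg_ballP/(_ _ e20) c2.
suff : \forall t \near F, ball (proj_img A t.1) e (proj_img (A_ t.2) t.1) by [].
apply: filterS (filterI V0 (filterI c1 c2)) => t [Vt [b1 b2]].
by rewrite !VE //; apply: ball_split (ball_sym b1) b2.
Qed.

(** [proj_img_near] controls the point and the index jointly; by the near-covering form of
    compactness, such local estimates yield one index that serves all of [C]. *)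
Lemma proj_img_unif (U : set PH) (C : set U) (A_ : nat -> 'M[H]_n.+1)
    (A : 'M[H]_n.+1) (e : R) : compact C ->
  (forall x : U, A *m (repr (set_val x) : nzvec) != 0) ->
  (forall i j, A_ k i j @[k --> \oo] --> A i j) -> 0 < e ->
  \forall k \near \oo, forall x, C x ->
    ball (proj_img A (set_val x)) e (proj_img (A_ k) (set_val x)).
Proof.
move=> /compact_near_coveringP cC AU cA e0.
apply: (cC nat \oo (fun k x => ball (proj_img A (set_val x)) e
  (proj_img (A_ k) (set_val x)))) => x _.
have /= := proj_img_near cA (AU x) e0 => -[[P Q] [Px Qoo] PQ].
exists (set_val @^-1` P, Q); first by split => //; exact: initial_continuous.
by move=> [y k] [/= Py Qk]; exact: (PQ (_, _)).
Qed.

Lemma family_cvg_projP (U : set PH) (fam : set (set U)) (u : nat -> U -> PH)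
    (f : U -> PH) :
  {family fam, u @ \oo --> f} <->
  forall C, fam C -> forall e : R, 0 < e ->
    \forall k \near \oo, forall x, C x -> ball (PH_mx (f x)) e (PH_mx (u k x)).
Proof.
rewrite fam_cvgP; split=> uf C fC.
  move=> e e0.
  apply: (uf C fC [set h | forall x, C x -> ball (f x) e (h x)]).
  apply/uniform_nbhs.
  by exists [set xy | ball xy.1 e xy.2]; split => //; rewrite -entourage_ballE; exists e.
move=> P /uniform_nbhs[E [/= entE EP]].
move: entE; rewrite -entourage_ballE => -[e /= e0 eE].
apply: filterS (uf C fC e e0) => k ke; apply: EP => x Cx.
by apply: eE; exact: ke.
Qed.

End ProjCvg.

(** * Powers of a Jordan matrix *)

Section BinomialInt.

(* the coefficient of [x ^ r] in [(1 + x) ^ k]; [Negz k] is [- (k + 1)] *)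
Definition binz (k : int) (r : nat) : int :=
  match k with
  | Posz k => 'C(k, r)%:Z
  | Negz k => (-1) ^+ r * 'C(k + r, r)%:Z
  end.

Lemma binz0r (k : int) : binz k 0 = 1.
Proof. by case: k => k; rewrite /binz ?addn0 ?bin0 ?mulr1. Qed.

Lemma binz_pascal (k : int) (r : nat) :
  binz (k + 1) r.+1 = binz k r.+1 + binz k r.
Proof.
case: k => [k|[|k]].
- by rewrite -PoszD addn1 /binz binS PoszD.
(* The exponent passes from -1 to 0: the coefficients of 1 / (1 + x) alternate between 1 and -1, so
   two consecutive ones cancel. *)
- rewrite (_ : Negz 0 + 1 = Posz 0) // /binz !add0n !binn bin0n /=.
  by rewrite !mulr1 exprS mulN1r addNr.
- rewrite (_ : Negz k.+1 + 1 = Negz k); last by rewrite !NegzE -addn1 PoszD; lia.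
  rewrite /binz (_ : (k.+1 + r.+1 = (k + r.+1).+1)%N); last by rewrite addSn.
  rewrite binS (_ : (k.+1 + r = k + r.+1)%N) ?addSnnS // PoszD exprS.
  by move: ('C(_, _)) ('C(_, _)) ((-1) ^+ r) => a b c; ring.
Qed.

End BinomialInt.

Section QuatC.
Variable R : realType.

Lemma quatCM (a b : R[i]) : quatC (a * b) = quatC a * quatC b.
Proof. by congr Quat; rewrite /= mul0r ?subr0 // mulr0 addr0. Qed.

Lemma quatCD (a b : R[i]) : quatC (a + b) = quatC a + quatC b.
Proof. by congr Quat; rewrite /= addr0. Qed.

Lemma quatC_real (r : R) : quatC (r%:C%C) = r *: (1 : quat R).
Proof. by congr Quat; rewrite /= ?mulr1 ?mulr0. Qed.

Lemma quat_norm1 : `|1 : quat R| = 1.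
Proof.
rewrite -[1]/(Quat 1 0) quat_normE /Defs.normq /sqnormq /=.
by rewrite expr1n !expr0n /= !addr0 sqrtr1.
Qed.

Lemma norm_quatC_eq0 (a : R[i]) : `|quatC a| = 1 -> a != 0.
Proof.
by move=> a1; apply/eqP => a0; move/eqP: a1; rewrite a0 normr0 eq_sym oner_eq0.
Qed.

Lemma norm_quatC_exprz (a : R[i]) (k : int) :
  `|quatC a| = 1 -> `|quatC (a ^ k)| = 1.
Proof.
move=> a1; have natpow m : `|quatC (a ^+ m)| = 1.
  by elim: m => [|m IH]; rewrite ?quat_norm1 // exprS quatCM quat_normM a1 IH mulr1.
case: k => m; first exact: natpow.
have am0 : a ^+ m.+1 != 0 by rewrite expf_neq0 // norm_quatC_eq0.
have := quat_norm1; rewrite -[1 in LHS]/(quatC 1) -(mulVf am0) quatCM quat_normM.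
by rewrite natpow mulr1.
Qed.

Lemma quatC_intr (m : int) : quatC (m%:~R : R[i]) = (m%:~R : R) *: (1 : quat R).
Proof. by rewrite -quatC_real rmorph_int. Qed.

End QuatC.

Section JordanPowers.
Variables (R : realType) (n : nat).
Local Notation H := (quat R).
Variables (st : nat -> nat) (mu : nat -> R[i]).

(* [st p] is the first index of the block containing [p], and [mu] at that
   index is the eigenvalue of the block *)
Definition jordan_form : 'M[H]_n.+1 :=
  \matrix_(p, q) if p == q then quatC (mu (st p))
    else if (q == p.+1 :> nat) && (st p == st q) then 1 else 0.

(** The closed formula for the [k]-th power. The exponent is an integer, so that powers of [g] and
    of its inverse are handled together. *)
Definition jordan_pow (k : int) : 'M[H]_n.+1 :=
  \matrix_(p, q) if (p <= q)%N && (st p == st q)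
    then quatC (mu (st p) ^ (k - (q - p)%N%:Z) * (binz k (q - p))%:~R) else 0.

Hypothesis st_itv : forall p q, (q < n.+1)%N -> (st q <= p <= q)%N -> st p = st q.
Hypothesis st_le : forall p, (p < n.+1)%N -> (st p <= p)%N.
Hypothesis mu0 : forall p, (p < n.+1)%N -> mu (st p) != 0.

Lemma st_between p q r : (r < n.+1)%N -> (p <= q <= r)%N -> st p = st r -> st q = st r.
Proof.
move=> rn /andP[pq qr] pr; apply: st_itv => //; rewrite qr -pr andbT.
exact: leq_trans (st_le (leq_ltn_trans (leq_trans pq qr) rn)) pq.
Qed.

(** Column [q] of the Jordan form has at most two nonzero entries, the eigenvalue at [q] and a 1 at
    [q - 1] within the same block. The product is therefore Pascal's rule for [binz] times a power
    of the eigenvalue. *)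
Lemma jordan_powS (k : int) : jordan_pow (k + 1) = jordan_pow k *m jordan_form.
Proof.
apply/matrixP => p q; rewrite [RHS]mxE (bigD1 q) //= [jordan_form q q]mxE eqxx.
have [q0|q_gt0] := posnP (q : nat).
  rewrite big1 ?addr0 => [|i iq]; last first.
    by rewrite [jordan_form _ _]mxE (negbTE iq) q0 mulr0.
  rewrite !mxE q0 leqn0 sub0n; case: ifP => [/andP[/eqP -> _]|_]; last by rewrite mul0r.
  rewrite !binz0r !mulr1 -quatCM !subr0 expfzDr ?expr1z // -q0.
  exact: mu0.
have [q' q'S] : exists q' : 'I_n.+1, q = q'.+1 :> nat.
  by exists (inord q.-1); rewrite inordK prednK // ltnW.
have q'q : q' != q by apply/eqP => E; move: q'S; rewrite E; lia.
rewrite (bigD1 q') //= big1 ?addr0 => [|i /andP[iq iq']]; last first.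
  rewrite [jordan_form _ _]mxE (negbTE iq) q'S eqSS eq_sym val_eqE (negbTE iq').
  by rewrite mulr0.
rewrite [jordan_form _ _]mxE (negbTE q'q) -q'S eqxx /= !mxE.
case: (ltngtP p q) => [pq|qp|pq] /=; last first.
- have -> : (p <= q')%N = false by rewrite pq q'S ltnn.
  rewrite pq eqxx subnn /= mul0r addr0 !binz0r !mulr1 -quatCM !subr0 expfzDr ?mu0 //.
  by rewrite expr1z addr0.
- have -> : (p <= q')%N = false by apply/negbTE; rewrite -ltnNge; lia.
  by rewrite !mul0r addr0.
have pq' : (p <= q')%N by rewrite -ltnS -q'S.
have q'n : (q' <= q)%N by rewrite q'S.
rewrite pq' /=; have [stpq|stpq] := eqVneq (st p) (st q); last first.
  rewrite mul0r add0r; case: eqP => [E|_]; last by rewrite mul0r.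
  by rewrite -E (negbTE stpq) mulr0.
have stq' : st q' = st q by apply: (@st_between p) => //; rewrite pq' q'n.
rewrite stq' stpq !eqxx mulr1 -quatCM -quatCD; congr quatC.
have qp : (q - p)%N = (q' - p).+1 by rewrite q'S subSn.
rewrite qp binz_pascal intrD mulrDr; congr (_ + _).
  rewrite mulrAC; congr (_ * _); rewrite -[X in _ * X]expr1z -expfzDr ?mu0 //.
  by congr (_ ^ _); lia.
by congr (_ ^ _ * _); lia.
Qed.

Lemma jordan_pow0 : jordan_pow 0 = 1%:M.
Proof.
apply/matrixP => p q; rewrite !mxE -[binz 0 _]/(Posz _) bin0n.
have [->|pq] := eqVneq p q; first by rewrite leqnn eqxx subnn /= mulr1.
case: ifP => // /andP[le_pq _].
by rewrite subn_eq0 leqNgt ltn_neqAle le_pq -val_eqE /= in pq *; rewrite pq mulr0.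
Qed.

Variable g : SL R n.
Hypothesis gE : SLval g = jordan_form.

(** The starting exponent is arbitrary: [j = 0] gives the positive powers, and [j = - k] identifies
    the inverse of [g ^+ k]. *)
Lemma jordan_powM (j : int) (k : nat) :
  jordan_pow j *m SLval (g ^+ k)%g = jordan_pow (j + k%:Z).
Proof.
elim: k j => [|k IH] j; first by rewrite addr0 -[SLval _]/(1%:M) mulmx1.
rewrite expgS -[SLval _]/(SLval g *m SLval (g ^+ k)%g) mulmxA gE -jordan_powS IH.
by rewrite -addrA -PoszD add1n.
Qed.

Lemma jordan_pow_expg (k : nat) : SLval (g ^+ k)%g = jordan_pow k%:Z.
Proof. by rewrite -[LHS]mul1mx -jordan_pow0 jordan_powM add0r. Qed.

Lemma jordan_pow_expVg (k : nat) : SLval (g ^- k)%g = jordan_pow (- k%:Z).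
Proof.
rewrite -[LHS]mul1mx -jordan_pow0 -(addNr k%:Z) -jordan_powM -mulmxA.
rewrite -[_ *m SLval _]/(SLval (g ^+ k * (g ^+ k)^-1)%g) divgg.
by rewrite -[SLval _]/(1%:M) mulmx1.
Qed.

Lemma psl_expg (k : nat) : psl (g ^+ k)%g = (psl g ^+ k)%g.
Proof.
elim: k => [|k IH] //; rewrite !expgS -IH.
by rewrite -[RHS]/(mulPSL _ _) mulPSLE.
Qed.

Lemma psl_expVg (k : nat) : psl (g ^- k)%g = (psl g ^- k)%g.
Proof.
apply/esym/mulg1_eq; rewrite -psl_expg -[LHS]/(mulPSL _ _) mulPSLE.
by rewrite -[mulSL _ _]/(g ^+ k * (g ^+ k)^-1)%g divgg.
Qed.

Lemma jordan_pow_neq0 (k : int) (v : 'cV[H]_n.+1) :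
  v != 0 -> jordan_pow k *m v != 0.
Proof.
move=> v0; have -> : jordan_pow k = SLval (if k is Posz m then (g ^+ m)%g else (g ^- `|k|)%g).
  by case: k => m; rewrite ?jordan_pow_expg // NegzE jordan_pow_expVg abszN.
exact: (SL_mulmx_neq0 _ (NZVec v0)).
Qed.

Lemma PH_mx_cyclic (h : PSL R n) : cyclic_subgroup (psl g) h ->
  exists k : int, forall p, PH_mx (act h p) = proj_img (jordan_pow k) p.
Proof.
move=> [k [] ->]; [exists k%:Z|exists (- k%:Z)] => p; rewrite -[in LHS](proj_ptK p).
  by rewrite -psl_expg actE PH_mxE /= jordan_pow_expg.
by rewrite -psl_expVg actE PH_mxE -[nzval _]/(SLval _ *m _) jordan_pow_expVg.
Qed.

Lemma PH_mx_expg (k : nat) p :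
  PH_mx (act (psl g ^+ k)%g p) = proj_img (jordan_pow k%:Z) p.
Proof. by rewrite -[in LHS](proj_ptK p) -psl_expg actE PH_mxE /= jordan_pow_expg. Qed.

End JordanPowers.

(** * Dynamics on projective space *)

Section ProjDiag.
Variables (R : realType) (n : nat).
Local Notation H := (quat R).
Local Notation proj_mx := Defs.proj_mx.

Lemma norm_proj_mx_diag (v : 'cV[H]_n.+1) i :
  `|proj_mx v i i| = (hnorm2 v)^-1 * `|v i 0| ^+ 2.
Proof.
rewrite mxE normrZ ger0_norm ?invr_ge0 ?sumr_ge0 // => [|j _]; last exact: sqnormq_ge0.
by rewrite quat_normM quat_norm_conj expr2.
Qed.

(** This is the trace of a projector of rank one. It prevents the diagonal entries from all being
    small, the final contradiction in [limit_space_not_Eq]. *)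
Lemma sum_norm_proj_mx_diag (v : 'cV[H]_n.+1) : v != 0 ->
  \sum_i `|proj_mx v i i| = 1.
Proof.
move=> v0; under eq_bigr do rewrite norm_proj_mx_diag.
rewrite -mulr_sumr -[X in _ * X](_ : hnorm2 v = _); last first.
  by apply: eq_bigr => i _; rewrite sqnormqE.
by rewrite mulVf // gt_eqF // (hnorm2_gt0 (NZVec v0)).
Qed.

Lemma proj_mx_diag_eq0 (v : 'cV[H]_n.+1) i : v != 0 ->
  (proj_mx v i i == 0) = (v i 0 == 0).
Proof.
move=> v0; rewrite -normr_eq0 norm_proj_mx_diag mulf_eq0 invr_eq0.
by rewrite (gt_eqF (hnorm2_gt0 (NZVec v0))) expf_eq0 /= normr_eq0.
Qed.

End ProjDiag.

Lemma norm_lt_triple (R : realType) (V : normedZmodType R) (a b c : V) (e : R) :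
  `|a| < e -> `|b - a| < e -> `|b - c| < e -> `|c| < 3 * e.
Proof.
move=> ae bae bce.
have -> : c = a + (b - a) - (b - c) by rewrite [a + _]addrC subrK subKr.
apply: le_lt_trans (ler_normB _ _) _.
apply: le_lt_trans (lerD (ler_normD _ _) (lexx _)) _.
by move: `|a| `|b - a| `|b - c| ae bae bce => x y z; lra.
Qed.

(** The quotient of [C(N, t + 1)] by [C(N, t)] is [(N - t) / (t + 1)], which for [t < K] is at least
    [(N - K) / K >= 1]. One step from [r] gains this factor, and the remaining steps up to [K - 1]
    lose nothing. *)
Lemma bin_growth (K N r : nat) : (2 * K <= N)%N -> (r.+1 < K)%N ->
  ('C(N, r) * (N - K) <= K * 'C(N, K.-1))%N.
Proof.
move=> KN rK.
have step t : (t < K)%N -> ('C(N, t) * (N - K) <= K * 'C(N, t.+1))%N.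
  move=> tK; have E := mul_bin_left N t.
  apply: leq_trans (_ : 'C(N, t) * (N - t) <= _)%N; first by rewrite leq_mul2l; lia.
  by rewrite mulnC -E leq_mul2r tK orbT.
have incr t : (t < K)%N -> ('C(N, t) <= 'C(N, t.+1))%N.
  move=> tK; have K0 : (0 < K)%N by lia.
  rewrite -(leq_pmul2l K0); apply: leq_trans (step t tK).
  by rewrite mulnC leq_mul2l; lia.
apply: leq_trans (step r (ltnW rK)) _; rewrite leq_mul2l; apply/orP; right.
have -> : K.-1 = (r.+1 + (K.-1 - r.+1))%N by lia.
have : (r.+1 + (K.-1 - r.+1) < K)%N by lia.
elim: (K.-1 - r.+1)%N => [|t IH]; rewrite ?addn0 // addnS => tK.
by apply: leq_trans (IH (ltnW tK)) _; exact/incr/ltnW.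
Qed.

Section JordanDynamics.
Variables (R : realType) (n : nat).
Local Notation H := (quat R).
Local Notation PH := (PH R n).
Local Notation nzvec := (nzvec R n).
Local Notation proj_mx := Defs.proj_mx.
Variables (st : nat -> nat) (mu : nat -> R[i]) (K : nat).
Local Notation T := (jordan_pow n st mu).

Hypothesis st_itv : forall p q, (q < n.+1)%N -> (st q <= p <= q)%N -> st p = st q.
Hypothesis st_le : forall p, (p < n.+1)%N -> (st p <= p)%N.
Hypothesis st_K : forall p, (p < n.+1)%N -> (p - st p < K)%N.
Hypothesis mu1 : forall p, (p < n.+1)%N -> `|quatC (mu (st p))| = 1.

(* the last indices, resp. the first indices, of the blocks of maximal size *)
Definition top (s : nat) : bool := (s - st s).+1 == K.
Definition head (p : 'I_n.+1) : bool := [exists s : 'I_n.+1, top s && (st s == p)].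

Lemma mu_neq0 p : (p < n.+1)%N -> mu (st p) != 0.
Proof. by move=> pn; rewrite norm_quatC_eq0 ?mu1. Qed.

Lemma K_gt0 : (0 < K)%N.
Proof. exact: leq_ltn_trans (st_K (ltn0Sn n)). Qed.

Lemma norm_jordan_pow (k : int) (p q : 'I_n.+1) :
  `|T k p q| = if (p <= q)%N && (st p == st q) then `|binz k (q - p)|%:~R else 0.
Proof.
rewrite mxE; case: ifP => _; last exact: normr0.
rewrite quatCM quat_normM norm_quatC_exprz ?mu1 // mul1r.
by rewrite quatC_intr normrZ quat_norm1 mulr1 intr_norm.
Qed.

Lemma block_dist (p q : 'I_n.+1) : (p <= q)%N -> st p = st q -> (q - p < K)%N.
Proof.
move=> pq E; apply: leq_ltn_trans (st_K (ltn_ord q)).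
by rewrite leq_sub2l // -E st_le.
Qed.

Definition pow_size (k : int) : R := \sum_(r < K) `|binz k r|%:~R.

Lemma le_pow_size (k : int) r : (r < K)%N -> `|binz k r|%:~R <= pow_size k.
Proof.
move=> rK; rewrite /pow_size (bigD1 (Ordinal rK)) //= lerDl sumr_ge0 //.
Qed.

Lemma pow_size_gt0 (k : int) : 0 < pow_size k.
Proof. by have := le_pow_size k K_gt0; rewrite binz0r; apply: lt_le_trans. Qed.

Definition npow (k : int) : 'M[H]_n.+1 := \matrix_(i, j) ((pow_size k)^-1 *: T k i j).

Lemma proj_img_npow k p : proj_img (npow k) p = proj_img (T k) p.
Proof. by apply: proj_imgZ; rewrite invr_eq0 gt_eqF // pow_size_gt0. Qed.

Lemma norm_npow (k : int) (p q : 'I_n.+1) :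
  `|npow k p q| = (pow_size k)^-1 * `|T k p q|.
Proof. by rewrite mxE normrZ ger0_norm // invr_ge0 ltW // pow_size_gt0. Qed.

Lemma norm_npow_le1 (k : int) (p q : 'I_n.+1) : `|npow k p q| <= 1.
Proof.
rewrite norm_npow norm_jordan_pow ler_pdivrMl ?pow_size_gt0 // mulr1.
case: ifP => [/andP[pq /eqP E]|_]; last by rewrite ltW // pow_size_gt0.
exact/le_pow_size/block_dist.
Qed.

(* If [r] is the offset of the first nonzero coefficient of the Toeplitz block
   of [A] ending at [s], then row [s - r] of [A *m v] is that coefficient times
   [v s 0]. *)
Lemma npow_limit_nonzero (k : nat -> int) (A : 'M[H]_n.+1) (s : 'I_n.+1)
    (v : 'cV[H]_n.+1) :
  (forall i j, npow (k t) i j @[t --> \oo] --> A i j) ->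
  top s -> v s 0 != 0 -> A *m v != 0.
Proof.
move=> cA /eqP tops vs.
(* Relations between entries that hold for every [t] pass to the limit; thus [A] inherits the
   triangular Toeplitz shape. *)
have limE i j i' j' : (forall t, npow (k t) i j = npow (k t) i' j') -> A i j = A i' j'.
  move=> E; apply: (cvg_unique _ (cA i j)); first exact: norm_hausdorff.
  by rewrite (funext E); exact: cA.
have lim0 i j : (forall t, npow (k t) i j = 0) -> A i j = 0.
  move=> E; apply: (cvg_unique _ (cA i j)); first exact: norm_hausdorff.
  by rewrite (funext E); exact: cvg_cst.
have sts := st_le (ltn_ord s).
have sn := ltn_ord s.
have stn r : (r < K)%N -> (st s + r < n.+1)%N by lia.
have ord_st r : (r < K)%N -> st (st s + r) = st s.
  by move=> rK; apply: st_itv => //; lia.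
have stst : st (st s) = st s by have := @ord_st 0%N K_gt0; rewrite addn0.
pose p : 'I_n.+1 := inord (st s).
have pE : p = st s :> nat by rewrite inordK //; lia.
have [r /andP[rK Ar] rmin] : exists2 r, (r < K)%N && (A p (inord (st s + r)) != 0) &
    forall r', (r' < r)%N -> A p (inord (st s + r')) = 0.
  have ex : exists r, (r < K)%N && (A p (inord (st s + r)) != 0).
    apply: contrapT => /forallNP A0.
    (* By the choice of [pow_size], the moduli in the first row of the block sum to 1 for each [t],
       so the limits in that row cannot all vanish. *)
    have : \sum_(r < K) `|A p (inord (st s + r))| = (1 : R).
      have c1 : (\sum_(r < K) `|npow (k t) p (inord (st s + r))|) @[t --> \oo] -->
          (\sum_(r < K) `|A p (inord (st s + r))| : R).
        apply: cvg_big => [|r _]; first exact: add_continuous.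
        by apply: cvg_norm; exact: cA.
      apply: (cvg_unique _ c1); first exact: norm_hausdorff.
      rewrite (_ : (fun _ => _) = (fun=> 1)); first exact: cvg_cst.
      apply/funext => t; under eq_bigr => r _.
        rewrite norm_npow norm_jordan_pow inordK ?stn // pE leq_addr.
        rewrite ord_st // stst eqxx addKn; over.
      by rewrite -mulr_sumr mulVf // gt_eqF // pow_size_gt0.
    rewrite big1 => [/eqP|r _]; first by rewrite eq_sym oner_eq0.
    apply/eqP; rewrite normr_eq0; apply/negPn/negP => Ar; apply: (A0 r).
    by rewrite ltn_ord Ar.
  case: (ex_minnP ex) => r Pr rmin; exists r => // r' r'r.
  apply/eqP/negPn/negP => Ar'; have := rmin r'; rewrite Ar'.
  have /andP[rK _] := Pr.
  by rewrite (ltn_trans r'r rK) leqNgt r'r => /(_ isT).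
have tn : (s - r < n.+1)%N by lia.
pose t : 'I_n.+1 := Ordinal tn.
have stt : st t = st s by apply: st_itv => //=; lia.
have sr : (st s + r <= s)%N by lia.
have Ats : A t s = A p (inord (st s + r)).
  apply: limE => i; rewrite !mxE; congr (_ *: _).
  rewrite stt pE inordK ?stn // ord_st // eqxx leq_addr leq_subr /=.
  rewrite stst eqxx /=.
  by rewrite addKn subKn //; lia.
apply/eqP => /colP/(_ t); rewrite !mxE (bigD1 s) //= big1 ?addr0 => [|q qs].
  apply/eqP; rewrite -normr_eq0 quat_normM mulf_eq0 !normr_eq0 (negbTE vs) orbF.
  by rewrite Ats.
(* The other columns contribute nothing: left of [t] by triangularity, right of [s] because the
   block ends at [s], and in between by minimality of [r]. *)
have [qt|tq] := ltnP q t.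
  rewrite lim0 ?mul0r // => i; rewrite !mxE leqNgt qt /= scaler0 //.
have [sq|qs'] := ltnP s q.
  rewrite lim0 ?mul0r // => i; rewrite !mxE tq /= stt.
  case: eqP => [E|_]; last by rewrite scaler0.
  have := st_K (ltn_ord q); rewrite -E; lia.
have {}qs' : (q < s)%N by rewrite ltn_neqAle qs' andbT.
have stq : st q = st s by apply: st_itv => //; move: tq => /=; lia.
rewrite (_ : A t q = A p (inord (st s + (q - t)))); last first.
  apply: limE => i; rewrite !mxE; congr (_ *: _).
  rewrite stt pE inordK ?stn //; last by move: tq => /=; lia.
  rewrite tq stq eqxx leq_addr addKn stst ord_st ?eqxx //.
  by move: tq => /=; lia.
by rewrite rmin ?mul0r //; move: tq => /=; lia.
Qed.

Lemma npow_subseq (k : nat -> int) :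
  exists2 phi : nat -> nat, {homo phi : i j / (i < j)%N} &
  exists A : 'M[H]_n.+1, forall i j, npow (k (phi t)) i j @[t --> \oo] --> A i j.
Proof.
by apply: (mx_bounded_subseq (A := fun t => npow (k t))) => t i j; exact: norm_npow_le1.
Qed.

(** * Equicontinuity off the subspace L *)

Variable g : SL R n.
Hypothesis gE : SLval g = jordan_form n st mu.

(** The subspace L, given by linear equations rather than by generators; [proj_span_std_pt] makes
    the link with the span. *)
Definition limit_space : set PH :=
  projectivization [set v : 'cV[H]_n.+1 | forall s : 'I_n.+1, top s -> v s 0 = 0].

Lemma limit_spaceP (z : nzvec) :
  limit_space (proj_pt z) <-> forall s : 'I_n.+1, top s -> nzval z s 0 = 0.
Proof.
apply: projectivizationP; split=> [s _|v w v0 w0 s ts|v a v0 s ts].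
- by rewrite mxE.
- by rewrite mxE v0 // w0 // addr0.
- by rewrite mxE v0 // mul0r.
Qed.

Lemma limit_spaceC (x : PH) :
  (~` limit_space) x <-> exists2 s : 'I_n.+1, top s & (repr x : nzvec) s 0 != 0.
Proof.
rewrite -{1}(proj_ptK x) /=; split=> [nx|[s ts xs] /limit_spaceP /(_ s ts) /eqP]; last first.
  by rewrite (negbTE xs).
apply: contrapT => nex; apply: nx; apply/limit_spaceP => s ts.
by apply/eqP/negPn/negP => xs; apply: nex; exists s.
Qed.

(** A coordinate of a point vanishes exactly when the corresponding diagonal entry of its projector
    does, and that entry is continuous on projective space. *)
Lemma limit_spaceC_open : open (~` limit_space).
Proof.
rewrite openE => x /limit_spaceC[s ts xs]; rewrite /interior.
have d0 : 0 < `|PH_mx x s s|.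
  by rewrite normr_gt0 proj_mx_diag_eq0 //; exact: nzvalP.
have cx : PH_mx y s s @[y --> x] --> PH_mx x s s.
  exact: (cvg_comp _ _ (@PH_mx_continuous R n x) (@cvg_coord R _ _ (PH_mx x) s s)).
move/cvgrPdist_lt: cx => /(_ _ d0); apply: filterS => y /= xy.
apply/limit_spaceC; exists s => //; rewrite -(@proj_mx_diag_eq0 _ _ _ s); last exact: nzvalP.
by apply/eqP => y0; move: xy; rewrite /PH_mx y0 subr0 ltxx.
Qed.

(** The whole complement of L serves as the neighbourhood of each of its points. The exponents of
    the given sequence are arbitrary integers, bounded or not: only the normalized matrices have to
    converge. *)
Lemma limit_spaceC_Eq : ~` limit_space `<=` Eq (cyclic_subgroup (psl g)).
Proof.
move=> z Lz; exists (~` limit_space); split=> // [|u uF]; first exact: limit_spaceC_open.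
have /choice[k kE] i : exists k : int, forall x, PH_mx (u i x) = proj_img (T k) (set_val x).
  have [h /(PH_mx_cyclic st_itv st_le mu_neq0 gE)[k hk] ->] := uF i.
  by exists k => x; exact: hk.
have [phi hphi [A cA]] := npow_subseq k.
exists phi => //.
have A0 (x : ~` limit_space) : A *m (repr (set_val x) : nzvec) != 0.
  have /limit_spaceC[s ts xs] : (~` limit_space) (set_val x) by exact/set_mem/valP.
  exact: npow_limit_nonzero cA ts xs.
exists (fun x => proj_pt (NZVec (A0 x))).
apply/family_cvg_projP => C cC e e0.
have := proj_img_unif cC A0 cA e0; apply: filterS => t /= Ct x Cx.
by rewrite PH_mxE kE -proj_img_npow; exact: Ct.
Qed.

(** * Failure of equicontinuity on L *)

Lemma below_top (p q : 'I_n.+1) : (p <= q)%N -> st p = st q ->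
  ~~ (head p && top q) -> (q - p < K.-1)%N.
Proof.
move=> pq E; apply: contraR; rewrite -leqNgt => Kqp.
have := st_K (ltn_ord q); have := st_le (ltn_ord p); rewrite E => stp qst.
have stE : st q = p by lia.
have tq : top q by rewrite /top; apply/eqP; lia.
by rewrite tq andbT; apply/existsP; exists q; rewrite tq stE eqxx.
Qed.

(** Two indices of one block are [K - 1] apart only as head and end of a maximal block. Every other
    nonzero entry has a smaller offset, and [bin_growth] compares it with the dominant
    coefficient. *)
Lemma jordan_pow_small (N : nat) (p q : 'I_n.+1) : (2 * K < N)%N ->
  ~~ (head p && top q) ->
  `|T N%:Z p q| <= 'C(N, K.-1)%:R * (K%:R / (N - K)%:R).
Proof.
move=> KN pq; rewrite norm_jordan_pow.
have r0 : 0 <= 'C(N, K.-1)%:R * (K%:R / (N - K)%:R) :> R.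
  by rewrite mulr_ge0 // divr_ge0.
case: ifP => // /andP[le_pq /eqP E]; have NK : (0 < N - K)%N by lia.
rewrite mulrA ler_pdivlMr ?ltr0n // -[`|_|]/(('C(N, q - p))%:Z) -pmulrn.
rewrite -!natrM ler_nat [leqRHS]mulnC bin_growth //; first by lia.
by have := below_top le_pq E pq; lia.
Qed.

Lemma jordan_pow_head (N : nat) (s : 'I_n.+1) : top s ->
  `|T N%:Z (inord (st s)) s| = 'C(N, K.-1)%:R.
Proof.
move=> /eqP ts; have sts := st_le (ltn_ord s); have sn := ltn_ord s.
rewrite norm_jordan_pow inordK; last by lia.
have -> : st (st s) = st s by apply: st_itv => //; rewrite leqnn.
rewrite sts eqxx /= -[`|_|]/(('C(N, s - st s))%:Z) -pmulrn.
by congr ('C(N, _)%:R); lia.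
Qed.

(** Distinct ends belong to distinct blocks, so the conditions at the various heads in
    [cancel_heads] are independent equations. *)
Lemma jordan_pow_head_top (k : int) (s q : 'I_n.+1) : top s -> top q -> q != s ->
  T k (inord (st s)) q = 0.
Proof.
move=> /eqP ts /eqP tq qs; have sts := st_le (ltn_ord s); have sn := ltn_ord s.
have stq := st_le (ltn_ord q).
rewrite mxE inordK; last by lia.
have -> : st (st s) = st s by apply: st_itv => //; rewrite leqnn.
case: ifP => // /andP[_ /eqP E]; case/eqP: qs; apply/val_inj => /=; lia.
Qed.

(* Moving the coordinates of [z] at the ends of the maximal blocks by
   [O(1 / N)] cancels the coordinates of [T N *m z] at the heads of these
   blocks, because those ends are multiplied there by the dominant binomial
   coefficient ['C(N, K.-1)]. *)
Lemma cancel_heads (N : nat) (z : 'cV[H]_n.+1) : (2 * K < N)%N ->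
  (forall s : 'I_n.+1, top s -> z s 0 = 0) ->
  exists v : 'cV[H]_n.+1, [/\ forall s : 'I_n.+1, ~~ top s -> v s 0 = z s 0,
    forall p, head p -> (T N%:Z *m v) p 0 = 0 &
    forall s, `|z s 0 - v s 0| <= K%:R / (N - K)%:R * \sum_q `|z q 0|].
Proof.
move=> KN z0.
have C0 : 0 < 'C(N, K.-1)%:R :> R by rewrite ltr0n bin_gt0; lia.
pose hd (s : 'I_n.+1) : 'I_n.+1 := inord (st s).
(* The condition at the head of the block of [s] involves only one unknown, the new coordinate at
   [s]; this is its solution. *)
pose ep s := - (T N%:Z (hd s) s)^-1 * (T N%:Z *m z) (hd s) 0.
exists (\col_s if top s then ep s else z s 0); split=> [s ts|p|s].
- by rewrite mxE (negbTE ts).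
- move=> /existsP[s /andP[ts /eqP ps]].
  have -> : p = hd s by apply/val_inj; rewrite /= inordK ps.
  have Tu : T N%:Z (hd s) s \is a GRing.unit.
    by rewrite unitqE -normr_eq0 jordan_pow_head // gt_eqF.
  rewrite mxE (bigD1 s) //= mxE ts /ep mulrA mulrN divrr // mulN1r.
  rewrite mxE [X in - X](bigD1 s) //= (z0 s) // mulr0 add0r.
  apply/eqP; rewrite addrC subr_eq0; apply/eqP/eq_bigr => q qs.
  rewrite mxE; case: ifP => // tq.
  by rewrite jordan_pow_head_top // !mul0r.
have sum0 : 0 <= \sum_q `|z q 0| by rewrite sumr_ge0.
rewrite mxE; case: ifP => ts; last by rewrite subrr normr0 mulr_ge0 // divr_ge0.
rewrite z0 // sub0r normrN /ep quat_normM normrN.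
have Tu : T N%:Z (hd s) s \is a GRing.unit.
  by rewrite unitqE -normr_eq0 jordan_pow_head // gt_eqF.
have -> : `|(T N%:Z (hd s) s)^-1| = ('C(N, K.-1)%:R)^-1.
  apply: (mulIf (x := 'C(N, K.-1)%:R)); first by rewrite gt_eqF.
  rewrite mulVf ?gt_eqF // -(jordan_pow_head N ts) -quat_normM mulVr //.
  exact: quat_norm1.
rewrite ler_pdivrMl // mxE; apply: le_trans (ler_norm_sum _ _ _) _.
rewrite mulrA mulr_sumr; apply: ler_sum => q _; rewrite quat_normM.
have [tq|tq] := boolP (top q); first by rewrite z0 // normr0 !mulr0.
by rewrite ler_wpM2r // jordan_pow_small // negb_and tq orbT.
Qed.

(** The limit map is known to be defined only off L, so [v] is moved along the coordinate [s0]. The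
    projector of the image depends continuously on the displacement, hence its head entries stay
    small. *)
Lemma leave_limit_space (N : nat) (v : 'cV[H]_n.+1) (s0 : 'I_n.+1) (e : R) :
  0 < e -> v != 0 -> (forall p, head p -> (T N%:Z *m v) p 0 = 0) ->
  exists w : 'cV[H]_n.+1, [/\ w s0 0 != 0, forall s, `|v s 0 - w s 0| < e &
    forall p, head p -> `|proj_mx (T N%:Z *m w) p p| < e].
Proof.
move=> e0 v0 hv.
pose w (x : R) : 'cV[H]_n.+1 := \col_s (v s 0 + (s == s0)%:R * (x *: (1 : H))).
have cw s : w x s 0 @[x --> (0 : R)] --> v s 0.
  have E : v s 0 + (s == s0)%:R * (0 *: (1 : H)) = v s 0 by rewrite scale0r mulr0 addr0.
  suff : (fun x => w x s 0) @ (0 : R) --> v s 0 + (s == s0)%:R * (0 *: (1 : H)).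
    by rewrite E.
  rewrite (_ : (fun x => w x s 0) =
    (fun x => v s 0 + (s == s0)%:R * (x *: (1 : H)))); last first.
    by apply/funext => x; rewrite mxE.
  apply: cvgD; first exact: cvg_cst.
  apply: cvg_mulq; first exact: cvg_cst.
  by apply: cvgZ; [exact: cvg_id|exact: cvg_cst].
have Tv0 : T N%:Z *m v != 0 by exact: (jordan_pow_neq0 st_itv st_le mu_neq0 gE).
have cp : proj_mx (T N%:Z *m w x) @[x --> (0 : R)] --> proj_mx (T N%:Z *m v).
  apply: cvg_proj_mx_col => // i; apply: cvg_mulmx_col => // *; exact: cvg_cst.
have good1 : \forall x \near (0 : R), forall s, `|v s 0 - w x s 0| < e.
  apply: (@filter_forall _ _ (fun s x => `|v s 0 - w x s 0| < e) _ (nbhs_filter (0 : R))) => s.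
  by move/cvgrPdist_lt: (cw s); exact.
have good2 : \forall x \near (0 : R), forall p, head p ->
    `|proj_mx (T N%:Z *m w x) p p| < e.
  apply: (@filter_forall _ _ (fun p x => head p ->
    `|proj_mx (T N%:Z *m w x) p p| < e) _ (nbhs_filter (0 : R))) => p.
  have [hp|nhp] := boolP (head p); last exact: nearW.
  have cpp : proj_mx (T N%:Z *m w x) p p @[x --> (0 : R)] --> (0 : H).
    rewrite [X in _ --> X](_ : _ = proj_mx (T N%:Z *m v) p p).
      exact: (cvg_comp _ _ cp (@cvg_coord R _ _ _ p p)).
    by apply/esym/eqP; rewrite proj_mx_diag_eq0 // hv.
  move/cvgrPdist_lt: cpp => /(_ e e0); apply: filterS => x.
  by rewrite sub0r normrN => xe _.
have /nbhs_ballP[d /= d0 dgood] : nbhs (0 : R) [set x |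
    (forall s, `|v s 0 - w x s 0| < e) /\
    forall p, head p -> `|proj_mx (T N%:Z *m w x) p p| < e].
  exact: filterI good1 good2.
have gx c : 1 < c -> (forall s, `|v s 0 - w (d / c) s 0| < e) /\
    forall p, head p -> `|proj_mx (T N%:Z *m w (d / c)) p p| < e.
  move=> c1; apply: dgood; rewrite -ball_normE /= sub0r normrN.
  have c0 : 0 < c by exact: lt_trans c1.
  by rewrite ger0_norm ?divr_ge0 ?ltW // ltr_pdivrMr // ltr_pMr.
(* The coordinate [s0] vanishes for at most one displacement, so one of [d / 2] and [d / 3] avoids
   this. *)
have [w2|w2] := eqVneq (w (d / 2) s0 0) 0; last first.
  by exists (w (d / 2)); have [] := gx 2 (ltr1n _ 2).
exists (w (d / 3)); have [g1 g2] := gx 3 (ltr1n _ 3); split=> //.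
apply/eqP => w3; have : w (d / 2) s0 0 - w (d / 3) s0 0 = 0 by rewrite w2 w3 subr0.
rewrite !mxE eqxx !mul1r opprD addrACA subrr add0r -scalerBl => /eqP.
rewrite scaler_eq0 oner_eq0 orbF -mulrBr mulf_eq0 gt_eqF //=.
by apply/negP/eqP; lra.
Qed.

(** Here [harmonic k] is [1 / (k + 1)], and [2 * (N - K) >= k + 1]. The bound depends on [k] only,
    which suits exponents [N k >= k]. *)
Lemma inv_subn_harmonic (N k : nat) : (2 * K < k)%N -> (k <= N)%N ->
  K%:R / (N - K)%:R <= K%:R * 2 * harmonic k :> R.
Proof.
move=> Kk kN; rewrite /harmonic /= -mulrA ler_wpM2l //.
rewrite ler_pdivlMr ?ltr0n // mulrC ler_pdivrMr ?ltr0n; last by lia.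
by rewrite -natrM ler_nat; lia.
Qed.

(** In a row that is no head, all entries are [O(1 / N)] times the dominant coefficient
    [C(N, K - 1)], which is itself at most [pow_size]. *)
Lemma npow_limit_row (N : nat -> nat) (A : 'M[H]_n.+1) (p q : 'I_n.+1) :
  {homo N : i j / (i < j)%N} ->
  (forall i j, npow (N t)%:Z i j @[t --> \oo] --> A i j) ->
  ~~ head p -> A p q = 0.
Proof.
move=> hN cA np; apply: (cvg_unique _ (cA p q)); first exact: norm_hausdorff.
apply/norm_cvg0P; have h0 : (K%:R * 2 * harmonic k) @[k --> \oo] --> (0 : R).
  rewrite -[X in _ --> X](mulr0 (K%:R * 2)).
  by apply: cvgM; [exact: cvg_cst|exact: cvg_harmonic].
apply: (squeeze_cvgr _ (cvg_cst (0 : R)) h0).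
exists (2 * K).+1 => // k /= Kk; rewrite normr_ge0 /=.
have kN := homo_ltn_ge k hN.
apply: le_trans (inv_subn_harmonic Kk kN).
rewrite norm_npow ler_pdivrMl ?pow_size_gt0 //.
apply: le_trans (jordan_pow_small (leq_trans Kk kN) _) _; first by rewrite negb_and np.
rewrite ler_wpM2r ?divr_ge0 //.
by have K1 := K_gt0; apply: (le_trans _ (@le_pow_size (N k)%:Z K.-1 _)); last by lia.
Qed.

Lemma approach_limit_space (z : nzvec) (s0 : 'I_n.+1) (N : nat -> nat) (e : R) :
  top s0 -> (forall s : 'I_n.+1, top s -> nzval z s 0 = 0) ->
  {homo N : i j / (i < j)%N} -> 0 < e ->
  exists2 w : nat -> nzvec, (forall s, nzval (w k) s 0 @[k --> \oo] --> nzval z s 0) &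
    \forall k \near \oo, nzval (w k) s0 0 != 0 /\
      forall p, head p -> `|proj_mx (T (N k)%:Z *m w k) p p| < e.
Proof.
(* The product bounds the displacement of [cancel_heads]; the added 1 is for [leave_limit_space]. *)
move=> ts0 zL hN e0; pose C : R := K%:R * 2 * \sum_q `|nzval z q 0| + 1.
have /choice[w wP] k : exists w : nzvec, (2 * K < k)%N ->
    [/\ nzval w s0 0 != 0, forall s, `|nzval z s 0 - nzval w s 0| <= C * harmonic k &
      forall p, head p -> `|proj_mx (T (N k)%:Z *m w) p p| < e].
  have [kK|Kk] := leqP k (2 * K); first by exists z.
  have kN := homo_ltn_ge k hN.
  have [v [vz hv zv]] := cancel_heads (leq_trans Kk kN) zL.
  have v0 : v != 0.
    apply: contra_neq (nzvalP z) => v0; apply/colP => s; rewrite mxE.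
    by have [/zL //|/vz <-] := boolP (top s); rewrite v0 mxE.
  (* The bound [e] is wanted for the projector, and [harmonic k] makes the points converge to
     [z]. *)
  have e'0 : 0 < Num.min e (harmonic k) by rewrite lt_min e0 harmonic_gt0.
  have [w [w0 vw hw]] := leave_limit_space s0 e'0 v0 hv.
  have wn0 : w != 0 by apply: contra_neq w0 => ->; rewrite mxE.
  exists (NZVec wn0) => _; split=> // [s|p /hw]; last by rewrite lt_min => /andP[].
  rewrite -[_ - _](subrKA (v s 0)) (le_trans (ler_normD _ _)) // /C mulrDl mul1r.
  apply: lerD; last by have := vw s; rewrite lt_min => /andP[_ /ltW].
  apply: le_trans (zv s) _; rewrite [leRHS]mulrAC ler_wpM2r ?sumr_ge0 //.
  exact: inv_subn_harmonic.
exists w; last by exists (2 * K).+1 => // k /= /wP[].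
move=> s; apply/subr_cvg0/norm_cvg0P.
have h0 : (C * harmonic k) @[k --> \oo] --> (0 : R).
  rewrite -[X in _ --> X](mulr0 C).
  by apply: cvgM; [exact: cvg_cst|exact: cvg_harmonic].
apply: (squeeze_cvgr _ (cvg_cst (0 : R)) h0).
by exists (2 * K).+1 => // k /= /wP[_ zw _]; rewrite normr_ge0 /= distrC zw.
Qed.

(** Normality is applied to powers whose normalized matrices already converge, so that the limit [f]
    can be compared with the map of [A] at points off L. *)
Lemma limit_space_not_Eq (s0 : 'I_n.+1) : top s0 ->
  Eq (cyclic_subgroup (psl g)) `<=` ~` limit_space.
Proof.
move=> ts0 z [U [oU Uz nF]] Lz.
have [phi0 hphi0 [A cA0]] := npow_subseq Posz.
pose u i (x : U) := act (psl g ^+ phi0 i)%g (set_val x).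
have [i|phi hphi [f uf]] := nF u.
  by exists (psl g ^+ phi0 i)%g => //; exists (phi0 i); left.
pose N k := phi0 (phi k).
have hN : {homo N : i j / (i < j)%N} by move=> i j ij; exact/hphi0/hphi.
have cA i j : npow (N k)%:Z i j @[k --> \oo] --> A i j.
  exact: (cvg_comp _ _ (homo_ltn_cvg hphi) (cA0 i j)).
have uE k x : PH_mx (u (phi k) x) = proj_img (T (N k)%:Z) (set_val x).
  exact: (PH_mx_expg st_itv st_le mu_neq0 gE).
pose zz : nzvec := repr z.
have zL : forall s : 'I_n.+1, top s -> nzval zz s 0 = 0.
  by apply/limit_spaceP; rewrite proj_ptK.
(* Each of the [n + 1] diagonal entries will be below [3 * eta], so that they sum to at most 3/4. *)
pose eta : R := (4 * n.+1%:R)^-1.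
have eta0 : 0 < eta by rewrite invr_gt0 mulr_gt0.
have [w cw wP] := approach_limit_space ts0 zL hN eta0.
have cq : proj_pt (w k) @[k --> \oo] --> z.
  apply/cvg_ballP => e e0.
  have cP : proj_mx (w k) @[k --> \oo] --> proj_mx zz.
    exact: (cvg_proj_mx_col _ (nzvalP zz) cw).
  move/cvg_ballP: cP => /(_ _ e0); apply: filterS => k.
  by rewrite PH_ballE PH_mxE.
pose zU : U := exist _ z (mem_set Uz).
pose q k : U := insubd zU (proj_pt (w k)).
have qE : \forall k \near \oo, set_val (q k) = proj_pt (w k).
  have : \forall k \near \oo, U (proj_pt (w k)).
    exact: (cq _ (open_nbhs_nbhs (conj oU Uz))).
  apply: filterS => k Uk.
  by rewrite -[LHS]/(\val (q k)) val_insubd mem_set.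
have cqU : q @ \oo --> zU.
  move=> P; rewrite {1}nbhsE => -[_ [[V oV <-] Vz] VP].
  have cV : \forall k \near \oo, V (proj_pt (w k)).
    exact: (cq _ (open_nbhs_nbhs (conj oV Vz))).
  by apply: filterS (filterI qE cV) => k [qk Vk]; apply: VP; rewrite /= qk.
(* The points [q k] and their limit form a compact set, on which the convergence is uniform. *)
have unif := (family_cvg_projP _ _ _).1 uf _ (compact_cvg_range cqU) eta eta0.
have [k [[wk0 wkh] [qk uk]]] := filter_ex (filterI wP (filterI qE unif)).
have qC i : (zU |` range q) (q i) by right; exists i.
have wkL : A *m w k != 0 by exact: npow_limit_nonzero cA ts0 wk0.
have small p : `|proj_mx (T (N k)%:Z *m w k) p p| < 3 * eta.
  have [hp|np] := boolP (head p).
    by apply: lt_le_trans (wkh p hp) _; lra.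
  (* The point [w k] stays fixed while [t] grows: the entry tends to that of [A *m w k], which is
     zero as [p] is no head. Both exponents [N t] and [N k] give values within [eta] of [f] there,
     which carries smallness from [t] to [k]. *)
  have c0 : proj_mx (npow (N t)%:Z *m w k) p p @[t --> \oo] --> (0 : H).
    rewrite [X in _ --> X](_ : _ = proj_mx (A *m w k) p p).
      have cB : proj_mx (npow (N t)%:Z *m w k) @[t --> \oo] --> proj_mx (A *m w k).
        apply: cvg_proj_mx_col => // i; apply: cvg_mulmx_col => // *; exact: cvg_cst.
      exact: (cvg_comp _ _ cB (@cvg_coord R _ _ _ p p)).
    apply/esym/eqP; rewrite proj_mx_diag_eq0 // mxE big1 // => j _.
    by rewrite (npow_limit_row j hN cA np) mul0r.
  move/cvgrPdist_lt: c0 => /(_ _ eta0) c0.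
  have [t [ut]] := filter_ex (filterI unif c0).
  rewrite sub0r normrN => tp.
  have [_ /(_ p p)] := uk _ (qC k); have [_ /(_ p p)] := ut _ (qC k).
  rewrite !uE qk -proj_img_npow !proj_img_pt -!ball_normE /=.
  by move=> ut' uk'; exact: norm_lt_triple tp ut' uk'.
have : \sum_p `|proj_mx (T (N k)%:Z *m w k) p p| < (1 : R).
  apply: le_lt_trans (_ : \sum_(p < n.+1) 3 * eta < 1).
    by apply: ler_sum => p _; exact/ltW/small.
  have etaE : eta *+ n.+1 = 4^-1.
    have n0 : (n.+1%:R : R) != 0 by rewrite pnatr_eq0.
    by rewrite -[LHS]mulr_natr /eta; move: (n.+1%:R) n0 => x x0; field.
  by rewrite sumr_const card_ord -mulrnAr etaE; lra.
rewrite sum_norm_proj_mx_diag ?ltxx //.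
exact: (jordan_pow_neq0 st_itv st_le mu_neq0 gE _ (nzvalP _)).
Qed.

End JordanDynamics.

(** * Entries of the Jordan form *)

Section BlockLayout.
Implicit Types (s : seq nat) (p q K : nat).

(* the first index of the block containing [p], for consecutive blocks whose
   sizes are listed in [s] *)
Fixpoint block_start s p : nat :=
  if s is k :: s' then if (p < k)%N then 0%N else (k + block_start s' (p - k))%N
  else 0%N.

Lemma block_start_le s p : (block_start s p <= p)%N.
Proof. by elim: s p => //= k s IH p; case: (ltnP p k) => // kp; have := IH (p - k)%N; lia. Qed.

Lemma block_start_itv s p q : (block_start s q <= p <= q)%N ->
  block_start s p = block_start s q.
Proof.
elim: s p q => //= k s IH p q; case: (ltnP q k) => [qk|kq] /andP[stp pq].
  by rewrite (leq_ltn_trans pq qk).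
by rewrite ltnNge (leq_trans (leq_addr _ _) stp) /= (IH _ (q - k)%N) //; lia.
Qed.

Lemma block_start_dist s p K : all (leq^~ K) s -> (p < sumn s)%N ->
  (p - block_start s p < K)%N.
Proof.
elim: s p => //= k s IH p /andP[kK sK] ps; case: (ltnP p k) => [pk|kp].
  by lia.
by rewrite subnDA IH //; lia.
Qed.

Lemma block_start_catr s1 s2 p : (sumn s1 <= p)%N ->
  block_start (s1 ++ s2) p = (sumn s1 + block_start s2 (p - sumn s1))%N.
Proof.
elim: s1 p => [|k s1 IH] p /=; first by rewrite subn0.
move=> sp; rewrite ltnNge (leq_trans (leq_addr _ _) sp) /= IH; last by lia.
by rewrite subnDA addnA.
Qed.

Lemma block_start_catl s1 s2 p : (p < sumn s1)%N ->
  block_start (s1 ++ s2) p = block_start s1 p.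
Proof.
by elim: s1 p => //= k s1 IH p ps; case: (ltnP p k) => // kp; rewrite IH //; lia.
Qed.

Lemma block_start_nseq l K p : (p < l * K)%N -> block_start (nseq l K) p = (p %/ K * K)%N.
Proof.
elim: l p => // l IH p; rewrite mulSn /= => plK.
case: (ltnP p K) => [pK|Kp]; first by rewrite divn_small.
have K0 : (0 < K)%N by case: K plK Kp {IH} => //; rewrite muln0.
rewrite IH; last by lia.
by rewrite -{2}(subnKC Kp) divnDl ?dvdnn // divnn K0 mulnDl mul1n.
Qed.

End BlockLayout.

Section JordanLayout.
Variable R : realType.
Local Notation H := (quat R).
Implicit Types (s : seq (nat * R[i])) (p q k : nat).

Fixpoint block_eig s p : R[i] :=
  if s is (k, a) :: s' then if (p < k)%N then a else block_eig s' (p - k) else 0.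

(** Entries are indexed by natural numbers, so that nested block matrices can be described without
    casts between their dimensions. *)
Fixpoint jordan_entry s p q : H :=
  if s is (k, a) :: s' then
    if (p < k)%N && (q < k)%N then
      if p == q then quatC a else if q == p.+1 then 1 else 0
    else if (k <= p)%N && (k <= q)%N then jordan_entry s' (p - k) (q - k) else 0
  else 0.

Local Notation sizes s := (map fst s).

(** Indices lie in the same block exactly when their blocks start at the same index; this turns the
    recursion into the shape of [jordan_form]. *)
Lemma jordan_entry_form s p q : all (leq 1) (sizes s) ->
  (p < sumn (sizes s))%N -> (q < sumn (sizes s))%N ->
  jordan_entry s p q =
    if p == q then quatC (block_eig s (block_start (sizes s) p))
    else if (q == p.+1) && (block_start (sizes s) p == block_start (sizes s) q)
      then 1 else 0.
Proof.
elim: s p q => //= -[k a] s IH p q /= /andP[k0 s0] ps qs.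
case: (ltnP p k) => pk; case: (ltnP q k) => qk /=.
- by rewrite k0 eqxx andbT.
- have -> : (p == q) = false by lia.
  by case: ifP => // /andP[_ /eqP]; lia.
- have -> : (p == q) = false by lia.
  by have -> : (q == p.+1) = false by lia.
rewrite IH //; [|lia|lia].
have -> : (p - k == q - k)%N = (p == q) by lia.
have -> : (q - k == (p - k).+1)%N = (q == p.+1) by lia.
by rewrite ltnNge leq_addr /= addKn eqn_add2l.
Qed.

Lemma jordan_entry_cat s1 s2 p q :
  jordan_entry (s1 ++ s2) p q =
  let N := sumn (sizes s1) in
  if (p < N)%N && (q < N)%N then jordan_entry s1 p q
  else if (N <= p)%N && (N <= q)%N then jordan_entry s2 (p - N) (q - N) else 0.
Proof.
elim: s1 p q => [|[k a] s1 IH] p q /=; first by rewrite !subn0.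
rewrite IH /=; case: (ltnP p k) => pk; case: (ltnP q k) => qk /=.
- by rewrite !ltn_addr.
- have -> : (k + sumn (sizes s1) <= p)%N = false by lia.
  by rewrite ?andbF /= ?if_same.
- have -> : (k + sumn (sizes s1) <= q)%N = false by lia.
  by rewrite ?andbF /= ?if_same.
rewrite !ltn_subLR // !subnDA !leq_subRL //.
Qed.

(** The dimension is tied to the list by an equation only, so the description survives [castmx] and
    the block constructions. *)
Definition jordan_desc s (N : nat) (M : 'M[H]_N) : Prop :=
  N = sumn (sizes s) /\ forall p q : 'I_N, M p q = jordan_entry s p q.

Lemma jordan_desc_cast s N N' (e : N = N') (M : 'M[H]_N) :
  jordan_desc s M -> jordan_desc s (castmx (e, e) M).
Proof. by case: N' / e; rewrite castmx_id. Qed.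

Lemma jordan_desc_block s1 s2 N1 N2 (M1 : 'M[H]_N1) (M2 : 'M[H]_N2) :
  jordan_desc s1 M1 -> jordan_desc s2 M2 ->
  jordan_desc (s1 ++ s2) (block_mx M1 0 0 M2).
Proof.
move=> [E1 h1] [E2 h2]; split; first by rewrite map_cat sumn_cat -E1 -E2.
move=> p q; rewrite jordan_entry_cat -E1 /=.
case: (split_ordP p) => p' ->; case: (split_ordP q) => q' ->.
- by rewrite block_mxEul h1.
- by rewrite block_mxEur mxE /= leqNgt ltn_ord.
- by rewrite block_mxEdl mxE /= [(N1 <= q')%N]leqNgt ltn_ord andbF.
- by rewrite block_mxEdr /= !leq_addr !addKn h2.
Qed.

Lemma jordan_desc_jordan_block (a : R[i]) k : jordan_desc [:: (k, a)] (jordan_block a k).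
Proof.
split=> [|p q]; first by rewrite /= addn0.
by rewrite mxE /= !ltn_ord.
Qed.

Lemma jordan_desc_mxdiag m (N : 'I_m -> nat) (s : 'I_m -> seq (nat * R[i]))
    (M : forall i, 'M[H]_(N i)) : (forall i, jordan_desc (s i) (M i)) ->
  jordan_desc (flatten [seq s i | i <- enum 'I_m]) (\mxdiag_i M i).
Proof.
elim: m N s M => [|m IH] N s M h.
  have E : enum 'I_0 = [::] by apply/size0nil; rewrite size_enum_ord.
  split=> [|p]; first by rewrite big_ord0 E.
  by exfalso; move: p; rewrite big_ord0; case.
rewrite enum_ordSl /= mxdiag_recl -map_comp.
apply/jordan_desc_cast/jordan_desc_block; first exact: h.
by apply: IH => i; exact: h.
Qed.

(** The diagonal part is treated as a list of Jordan blocks of size 1. *)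
Lemma jordan_desc_diag N (d : 'rV[R[i]]_N) :
  jordan_desc [seq (1%N, a) | a <- [seq d 0 i | i <- enum 'I_N]]
    (diag_mx (map_mx (@quatC R) d)).
Proof.
set t := [seq d 0 i | i <- _]; have tN : size t = N by rewrite size_map size_enum_ord.
split=> [|p q].
  by rewrite -map_comp (eq_map (_ : _ =1 fun=> 1%N)) // -tN; elim: (t) => //= a u ->.
have -> : diag_mx (map_mx (@quatC R) d) p q =
    if p == q :> nat then quatC (nth 0 t p) else 0.
  rewrite !mxE (nth_map p) ?size_enum_ord // nth_ord_enum.
  by have [->|pq] := eqVneq p q; rewrite ?eqxx // val_eqE (negbTE pq).
have : (p < size t)%N by rewrite tN.
have : (q < size t)%N by rewrite tN.
elim: t {tN} (p : nat) (q : nat) => //= a t IH [|p'] [|q'] //= qt pt.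
by rewrite !subSS !subn0 eqSS IH.
Qed.

Definition jordan_blocks (m : nat) (k l : nat -> nat) (d : 'rV[R[i]]_(k 1%N))
    (lam : nat -> nat -> R[i]) : seq (nat * R[i]) :=
  [seq (1%N, a) | a <- [seq d 0 i | i <- enum 'I_(k 1%N)]] ++
  flatten [seq flatten [seq [:: (k i.+2, lam i.+2 j.+1)] | j : 'I_(l i.+2) <- enum 'I_(l i.+2)]
    | i : 'I_m.-1 <- enum 'I_m.-1].

Lemma jordan_desc_jordan_mx m (k l : nat -> nat) (d : 'rV[R[i]]_(k 1%N))
    (lam : nat -> nat -> R[i]) :
  jordan_desc (jordan_blocks m l d lam) (jordan_mx m l d lam).
Proof.
apply: jordan_desc_block; first exact: jordan_desc_diag.
apply: jordan_desc_mxdiag => i; apply: jordan_desc_mxdiag => j.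
exact: jordan_desc_jordan_block.
Qed.

End JordanLayout.

(** * Block sizes and the ends of the maximal blocks *)

Section BlockSizes.
Implicit Types (k l : nat -> nat).

Lemma map_fst_pair (T U : Type) (x : T) (r : seq U) :
  map fst [seq (x, y) | y <- r] = nseq (size r) x.
Proof. by elim: r => //= a r ->. Qed.

(** Besides the diagonal part, this covers the sizes of index 2 to [t + 1]. With [m = t + 2] it
    stops just before the maximal blocks, and its sum is then [B]. *)
Definition size_layout k l t : seq nat :=
  nseq (k 1%N) 1%N ++ flatten [seq nseq (l i.+2) (k i.+2) | i <- iota 0 t].

Lemma size_layoutS k l t :
  size_layout k l t.+1 = size_layout k l t ++ nseq (l t.+2) (k t.+2).
Proof.
have E : iota 0 t.+1 = iota 0 t ++ [:: t] by rewrite -addn1 iotaD.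
by rewrite /size_layout E map_cat flatten_cat /= cats0 catA.
Qed.

Lemma sumn_size_layout k l t :
  sumn (size_layout k l t) = (k 1 + \sum_(2 <= i < t.+2) l i * k i)%N.
Proof.
elim: t => [|t IH]; last first.
  by rewrite size_layoutS sumn_cat IH sumn_nseq [in RHS]big_nat_recr //= addnA (mulnC (k _)).
by rewrite /size_layout cats0 sumn_nseq mul1n big_geq ?addn0.
Qed.

Lemma all_size_layout (P : pred nat) k l t : P 1%N ->
  (forall i, (2 <= i < t.+2)%N -> P (k i)) -> all P (size_layout k l t).
Proof.
move=> P1; elim: t => [|t IH] Pk.
  by rewrite /size_layout cats0 all_nseq P1 orbT.
rewrite size_layoutS all_cat all_nseq Pk ?ltnS ?leqnn // orbT andbT.
by apply: IH => i /andP[i2 it]; apply: Pk; rewrite i2 ltnW.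
Qed.

Lemma sizes_jordan_blocks (R : realType) m k l (d : 'rV[R[i]]_(k 1%N)) lam :
  map fst (jordan_blocks m l d lam) = size_layout k l m.-1.
Proof.
rewrite /jordan_blocks map_cat; congr (_ ++ _).
  by rewrite map_fst_pair size_map size_enum_ord.
rewrite map_flatten -map_comp -val_enum_ord -[in RHS]map_comp; congr flatten.
apply: eq_map => i /=; rewrite flatten_map1.
rewrite (map_comp (pair (k i.+2)) (fun j : 'I_(l i.+2) => lam i.+2 j.+1)).
by rewrite map_fst_pair size_map size_enum_ord.
Qed.

(** In the prefix all blocks are shorter than [K], so no offset reaches [K - 1]. Beyond it the
    offset is a remainder modulo [K]. Since [s] counts from 0, the successor of [s] is the index of
    the basis vector. *)
Lemma last_of_max_block (pre : seq nat) (l K s : nat) :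
  all (leq^~ K.-1) pre -> (0 < K)%N -> (s < sumn pre + l * K)%N ->
  ((s - block_start (pre ++ nseq l K) s).+1 == K) <->
  exists2 j, (1 <= j <= l)%N & s.+1 = (sumn pre + j * K)%N.
Proof.
move=> preK K0 sl; have [sB|Bs] := ltnP s (sumn pre).
  rewrite block_start_catl //; have := block_start_dist preK sB => sK.
  split=> [/eqP|[j /andP[j1 _]] E]; first by lia.
  by exfalso; nia.
rewrite block_start_catr // block_start_nseq; last by lia.
set t := (s - sumn pre)%N; have sE : s = (sumn pre + t)%N by rewrite subnKC.
have tl : (t < l * K)%N by lia.
have E : (s - (sumn pre + t %/ K * K) = t %% K)%N.
  by rewrite sE subnDl {1}(divn_eq t K) addKn.
rewrite E; split=> [/eqP tK|[j /andP[j1 jl] jE]].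
  exists (t %/ K).+1; last by rewrite sE mulSn {1}(divn_eq t K); lia.
  by rewrite /= ltn_divLR.
have -> : t = (j.-1 * K + K.-1)%N by case: j j1 jl jE => // j _ _; rewrite mulSn /=; lia.
by rewrite modnMDl modn_small ?prednK // ltn_predL.
Qed.

End BlockSizes.

(** * Coordinate subspaces and eigenvectors *)

Section SpanStd.
Variables (R : realType) (n : nat).
Local Notation H := (quat R).

Lemma col_sum_rscale_delta (v : 'cV[H]_n.+1) :
  v = \sum_s rscale (delta_mx s 0) (v s 0).
Proof.
apply/colP => i; rewrite summxE (bigD1 i) //= mxE mxE !eqxx mul1r big1 ?addr0 // => s si.
by rewrite !mxE eq_sym (negbTE si) mul0r.
Qed.

(** The coordinate subspace contains the given points. Conversely, its vectors are right
    combinations of the corresponding basis vectors, hence lie in every subspace containing these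
    points. *)
Lemma proj_span_std_pt (P : 'I_n.+1 -> Prop) :
  proj_span [set p | exists2 s, P s & p = std_pt R s] =
  projectivization [set v | forall s, ~ P s -> v s 0 = 0].
Proof.
have hV : right_subspace [set v : 'cV[H]_n.+1 | forall s, ~ P s -> v s 0 = 0].
  split=> [s _|v w v0 w0 s Ps|v a v0 s Ps]; rewrite mxE //.
    by rewrite v0 // w0 // addr0.
  by rewrite v0 // mul0r.
apply/seteqP; split.
  apply: smallest_sub; first by exists [set v | forall s, ~ P s -> v s 0 = 0].
  move=> p [s Ps ->]; exists (NZVec (@delta_neq0 R n s)) => // t nPt.
  by rewrite mxE andbT; case: eqP => // ts; case: nPt; rewrite ts.
move=> p [z hz <-] S [[V hV' ->] SV]; apply/projectivizationP => //.
have [V0 VD VZ] := hV'.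
rewrite (col_sum_rscale_delta z); apply: (big_ind V) => // s _.
have [Ps|nPs] := pselect (P s); last by rewrite (hz s nPs) rscale0.
apply: VZ; have /SV : [set p | exists2 s, P s & p = std_pt R s] (std_pt R s) by exists s.
by move/(projectivizationP _ hV').
Qed.

(** The first basis vector of a block is an eigenvector; through it parabolicity forces [mu] to have
    modulus 1 on each block. *)
Lemma jordan_form_eigenvalue (st : nat -> nat) (mu : nat -> R[i]) (p : nat) :
  (forall p, (st p <= p)%N) -> (forall p, st (st p) = st p) -> (p < n.+1)%N ->
  right_eigenvalue (jordan_form n st mu) (quatC (mu (st p))).
Proof.
move=> st_le stK pn; have spn := leq_ltn_trans (st_le p) pn.
exists (delta_mx (Ordinal spn) 0); first exact: delta_neq0.
rewrite -colE; apply/colP => i; rewrite !mxE eqxx andbT.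
have [->|ni] := eqVneq i (Ordinal spn); first by rewrite mul1r /= stK.
rewrite mul0r; case: ifP => //= /andP[/eqP E /eqP]; rewrite stK.
by move=> sti; have := st_le i; lia.
Qed.

End SpanStd.

Theorem theorem4p5 (R : realType) (n m : nat) (k l : nat -> nat)
    (d : 'rV[R[i]]_(k 1%N)) (lam : nat -> nat -> R[i])
    (gamma : PSL R n) (g : SL R n)
    (gamma_parabolic : parabolic gamma)
    (g_lift : psl g = gamma)
    (m_ge2 : (2 <= m)%N)
    (l_ge1 : forall i, (2 <= i <= m)%N -> (1 <= l i)%N)
    (k_ge2 : forall i, (2 <= i <= m)%N -> (2 <= k i)%N)
    (k_lt : forall i, (2 <= i < m)%N -> (k i < k i.+1)%N)
    (dim_eq : (k 1 + \sum_(2 <= i < m.+1) l i * k i = n.+1)%N)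
    (d_Im : forall s, 0 <= complex.Im (d 0 s))
    (lam_Im : forall i j, (2 <= i <= m)%N -> (1 <= j <= l i)%N ->
       0 <= complex.Im (lam i j))
    (g_jordan : exists e : (k 1 + \sum_(i < m.-1) \sum_(j < l i.+2) k i.+2)%N
                           = n.+1,
       SLval g = castmx (e, e) (jordan_mx m l d lam)) :
  let B := (k 1 + \sum_(2 <= i < m) l i * k i)%N in
  Eq (cyclic_subgroup gamma) =
  ~` proj_span [set p | exists2 s : 'I_n.+1,
       (forall j, (1 <= j <= l m)%N -> s.+1 <> (B + j * k m)%N) &
       p = std_pt R s].
Proof.
move=> B; subst gamma.
case: m m_ge2 l_ge1 k_ge2 k_lt dim_eq lam_Im g_jordan @B => [|[|t]] // _.
move=> l_ge1 k_ge2 k_lt dim_eq _ [e gE] B.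
pose bl := jordan_blocks t.+2 l d lam.
have szE : map fst bl = size_layout k l t.+1 by exact: sizes_jordan_blocks.
have BE : sumn (size_layout k l t) = B by exact: sumn_size_layout.
(* With size at least 2, the maximal blocks are strictly larger than the size-1 blocks of the
   diagonal part. *)
have K_ge2 : (2 <= k t.+2)%N by rewrite k_ge2 // ltnS leqnn.
have k_mono u : (u <= t.+2)%N -> forall i, (2 <= i < u)%N -> (k i < k u)%N.
  elim: u => [|u IH] ut i /andP[i2 iu]; first by rewrite ltn0 in iu.
  have ku : (k u < k u.+1)%N by apply: k_lt; lia.
  move: iu; rewrite ltnS leq_eqVlt => /predU1P[->//|iu].
  by apply: ltn_trans ku; apply: IH; rewrite ?i2 // ltnW.
have kK i : (2 <= i < t.+2)%N -> (k i <= (k t.+2).-1)%N.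
  by move=> it; have := k_mono _ (leqnn _) _ it; lia.
have [dimE gent] : jordan_desc bl (SLval g).
  rewrite gE; apply: jordan_desc_cast; exact: jordan_desc_jordan_mx.
pose st := block_start (map fst bl); pose mu := block_eig bl.
have gform : SLval g = jordan_form n st mu.
  apply/matrixP => p q; rewrite gent mxE jordan_entry_form -?dimE //.
  rewrite szE; apply: all_size_layout => // i /andP[i2 it].
  by apply: ltnW; apply: k_ge2; lia.
have st_le p : (st p <= p)%N by exact: block_start_le.
have stK p : st (st p) = st p by apply: block_start_itv; rewrite leqnn st_le.
have st_itv p q : (q < n.+1)%N -> (st q <= p <= q)%N -> st p = st q.
  by move=> _; exact: block_start_itv.
have st_K p : (p < n.+1)%N -> (p - st p < k t.+2)%N.
  rewrite dimE; apply: block_start_dist; rewrite szE.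
  apply: all_size_layout => [|i /andP[i2 it]]; first by rewrite ltnW.
  have [->//|it'] := eqVneq i t.+2.
  by apply: ltnW; apply: k_mono => //; lia.
have mu1 p : (p < n.+1)%N -> `|quatC (mu (st p))| = 1.
  move=> pn; have [_ par] := gamma_parabolic; apply: (par g) => //.
  by rewrite gform; exact: jordan_form_eigenvalue.
have dimB : n.+1 = (B + l t.+2 * k t.+2)%N.
  by rewrite dimE szE size_layoutS sumn_cat sumn_nseq BE mulnC.
have topE (s : 'I_n.+1) : top st (k t.+2) s <->
    exists2 j, (1 <= j <= l t.+2)%N & s.+1 = (B + j * k t.+2)%N.
  rewrite /top /st szE size_layoutS -BE; apply: last_of_max_block.
  - by apply: all_size_layout => //; lia.
  - by lia.
  - by rewrite BE -dimB.
have l1 : (1 <= l t.+2)%N by rewrite l_ge1 // ltnS leqnn.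
(* The end of the first maximal block, at position [B + k t.+2 - 1] when counting from 0. *)
have [s0 ts0] : exists s0 : 'I_n.+1, top st (k t.+2) s0.
  have Bn : ((B + k t.+2).-1 < n.+1)%N by rewrite dimB; nia.
  by exists (Ordinal Bn); apply/topE; exists 1%N; rewrite ?l1 //= mul1n; lia.
have -> : proj_span [set p | exists2 s : 'I_n.+1,
       (forall j, (1 <= j <= l t.+2)%N -> s.+1 <> (B + j * k t.+2)%N) &
       p = std_pt R s] = @limit_space R n st (k t.+2).
  rewrite proj_span_std_pt; congr projectivization; apply/seteqP.
  split=> v /= v0 s.
    by move/topE => [j jl sj]; apply: v0 => ns; exact: ns sj.
  move=> ns; apply: v0; apply/topE; apply: contrapT => nex; apply: ns => j jl sj.
  by apply: nex; exists j.
apply/seteqP; split.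
  exact: (limit_space_not_Eq st_itv (fun p _ => st_le p) st_K mu1 gform ts0).
exact: (limit_spaceC_Eq st_itv (fun p _ => st_le p) st_K mu1 gform).
Qed.
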